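(* Assume the $3$-uniform $4$-hyperclique hypothesis. Then for no $\varepsilon>0$ is there an algorithm running in $O(m^{4/3-\varepsilon})$ time, nor one running in $O(n^{2-\varepsilon})$ time, that decides whether an undirected $n$-node, $m$-edge graph contains an induced $4$-cycle. This holds already for graphs with $m=O(n^{3/2})$.
   Context: The $3$-uniform $4$-hyperclique hypothesis: on a word-RAM with $O(\log n)$-bit words, for no $\varepsilon>0$ can one decide in $O(n^{4-\varepsilon})$ time whether an $n$-vertex $3$-uniform hypergraph contains $4$ vertices all of whose $3$-element subsets are hyperedges. *)

(* Defs.v *)
From Stdlib Require Import Reals List Arith Permutation.
Import ListNotations.
Open Scope R_scope.

(* Word-RAM.  Memory is an unbounded array of words (cells indexed by  *)
(* nat); every word is kept reduced modulo 2^w, w = word size.         *)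

Inductive binop : Type :=
| OAdd | OSub | OMul | ODiv | OMod | OAnd | OOr | OXor | OShl | OShr.

Definition binop_eval (o : binop) (x y : nat) : nat :=
  match o with
  | OAdd => x + y
  | OSub => x - y            (* truncated subtraction *)
  | OMul => x * y
  | ODiv => Nat.div x y      (* x / 0 = 0 *)
  | OMod => Nat.modulo x y   (* x mod 0 = x *)
  | OAnd => Nat.land x y
  | OOr  => Nat.lor x y
  | OXor => Nat.lxor x y
  | OShl => Nat.shiftl x y
  | OShr => Nat.shiftr x y
  end%nat.

Inductive instr : Type :=
| IConst (d k : nat)              (* M[d] := k                      *)
| IBin (o : binop) (d a b : nat)  (* M[d] := M[a] o M[b]            *)
| ILoad (d a : nat)               (* M[d] := M[M[a]]  (indirect)    *)
| IStore (a s : nat)              (* M[M[a]] := M[s]  (indirect)    *)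
| IJmp (t : nat)
| IJz (a t : nat)                 (* if M[a] = 0 then goto t        *)
| IHalt (a : nat).                (* halt; accept iff M[a] <> 0     *)

Definition program := list instr.

Inductive result : Type :=
| Running (pc : nat) (mem : nat -> nat)
| Halted (accept : bool).

Definition upd (w : nat) (mem : nat -> nat) (d v : nat) : nat -> nat :=
  fun i => if Nat.eqb i d then (v mod 2 ^ w)%nat else mem i.

Definition step (w : nat) (p : program) (pc : nat) (mem : nat -> nat) : result :=
  match nth_error p pc with
  | None => Halted false
  | Some (IConst d k) => Running (S pc) (upd w mem d k)
  | Some (IBin o d a b) => Running (S pc) (upd w mem d (binop_eval o (mem a) (mem b)))
  | Some (ILoad d a) => Running (S pc) (upd w mem d (mem (mem a)))
  | Some (IStore a s) => Running (S pc) (upd w mem (mem a) (mem s))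
  | Some (IJmp t) => Running t mem
  | Some (IJz a t) => if Nat.eqb (mem a) 0 then Running t mem else Running (S pc) mem
  | Some (IHalt a) => Halted (negb (Nat.eqb (mem a) 0))
  end.

Fixpoint exec (w : nat) (p : program) (t : nat) (r : result) : result :=
  match t with
  | O => r
  | S t' => match r with
            | Halted b => Halted b
            | Running pc mem => exec w p t' (step w p pc mem)
            end
  end.

Definition init_state (w : nat) (input : list nat) : result :=
  Running 0 (fun i => (nth i input 0 mod 2 ^ w)%nat).

Definition word_size (c N : nat) : nat := (c * S (Nat.log2 N))%nat.

Definition decides_in_time {X : Type} (valid : X -> Prop) (enc : X -> list nat)
  (sz : X -> nat) (P : X -> Prop) (param : X -> nat) (f : nat -> R) : Prop :=
  exists (p : program) (c : nat),
    (forall x, valid x ->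
       exists (t : nat) (b : bool),
         exec (word_size c (sz x)) p t (init_state (word_size c (sz x)) (enc x)) = Halted b
         /\ (b = true <-> P x)) /\
    exists (C : R) (n0 : nat),
      forall x, valid x -> (n0 <= param x)%nat ->
        exists (t : nat) (b : bool),
          INR t <= C * f (param x) /\
          exec (word_size c (sz x)) p t (init_state (word_size c (sz x)) (enc x)) = Halted b
          /\ (b = true <-> P x).

(* Undirected simple graphs: (n, E), vertices 0..n-1, each edge listed *)
(* once as (u,v) with u < v < n.  Encoding: n :: m :: u1 :: v1 :: ...  *)

Definition graph := (nat * list (nat * nat))%type.

Definition valid_graph (G : graph) : Prop :=
  NoDup (snd G) /\ forall u v, In (u, v) (snd G) -> (u < v < fst G)%nat.

Definition gn (G : graph) : nat := fst G.
Definition gm (G : graph) : nat := length (snd G).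

Definition enc_graph (G : graph) : list nat :=
  fst G :: length (snd G) :: flat_map (fun e => [fst e; snd e]) (snd G).

Definition adj (G : graph) (u v : nat) : Prop :=
  In (u, v) (snd G) \/ In (v, u) (snd G).

Definition has_induced_C4 (G : graph) : Prop :=
  exists a b c d, NoDup [a; b; c; d] /\
    adj G a b /\ adj G b c /\ adj G c d /\ adj G d a /\
    ~ adj G a c /\ ~ adj G b d.

(* 3-uniform hypergraphs: (n, H), each hyperedge listed once as        *)
(* (a,b,c) with a < b < c < n.  Encoding n :: |H| :: a1::b1::c1 :: ... *)

Definition hypergraph := (nat * list (nat * nat * nat))%type.

Definition valid_hypergraph (H : hypergraph) : Prop :=
  NoDup (snd H) /\ forall a b c, In (a, b, c) (snd H) -> (a < b < c /\ c < fst H)%nat.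

Definition enc_hypergraph (H : hypergraph) : list nat :=
  fst H :: length (snd H)
        :: flat_map (fun e => match e with (a, b, c) => [a; b; c] end) (snd H).

Definition hedge (H : hypergraph) (x y z : nat) : Prop :=
  exists a b c, In (a, b, c) (snd H) /\ Permutation [a; b; c] [x; y; z].

Definition has_4_hyperclique (H : hypergraph) : Prop :=
  exists a b c d, NoDup [a; b; c; d] /\
    hedge H a b c /\ hedge H a b d /\ hedge H a c d /\ hedge H b c d.

Definition hyperclique_hypothesis : Prop :=
  forall eps : R, 0 < eps ->
    ~ decides_in_time valid_hypergraph enc_hypergraph fst has_4_hyperclique fst
        (fun n => Rpower (INR n) (4 - eps)).

Definition valid_graph_K (K : R) (G : graph) : Prop :=
  valid_graph G /\ INR (gm G) <= K * Rpower (INR (gn G)) (3 / 2).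

(* Main.v *)
(* Take four disjoint copies of the set of pairs [(x, y)] of vertices of the
   hypergraph, join [(x, y)] in the [i]-th copy to [(y, z)] in the next copy
   (cyclically) when [xyz] is a hyperedge, and make the pairs of one copy with
   the same first entry a clique.  Going once around the copies spells a
   4-hyperclique, and the cliques destroy every other induced 4-cycle.  The graph
   has 4 n^2 nodes and O(n^3) edges, so time O(m^(4/3 - e)) or O(N^(2 - e)) for it
   is O(n^(4 - e')).  The reduction is carried out on the word-RAM itself: a
   program writes the encoding of the graph, computes the word size that the given
   algorithm would see, and then simulates the algorithm, reducing every value
   modulo that smaller power of two. *)

Require Import Defs.
From Stdlib Require Import Reals List Arith Permutation Lia Lra.
Import ListNotations.
Open Scope nat_scope.

(** * The graph of a hypergraph *)

(** The assumed algorithm may exploit overflow, and its word size is tied to the [4 n^2] nodes, not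
    to [n]; so its machine has to be reproduced word for word inside larger words. Two features of
    the memory shape the rest. The input fills the cells from 0 on, so no free address is known in
    advance. And the simulated memory must read 0 from the end of its encoding up to every address
    the algorithm can reach, be it a word below [2 ^ wg] or an address in the program text. Both are
    met by moving the hyperedges to a cell [F] beyond this whole range, polynomial in [n] with an
    exponent that depends only on the algorithm. Writing the graph costs O(n^3), which stays within
    O(n^(4 - e)) as long as e <= 1. *)

Lemma NoDup_flat_map {A B : Type} (f : A -> list B) (l : list A) :
  NoDup l -> (forall x, In x l -> NoDup (f x)) ->
  (forall x y z, In x l -> In y l -> In z (f x) -> In z (f y) -> x = y) ->
  NoDup (flat_map f l).
Proof.
  induction 1 as [|a l Ha Hl IH]; intros Hf Hd; simpl; [constructor|].
  apply NoDup_app.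
  - apply Hf; left; reflexivity.
  - apply IH.
    + intros x Hx; apply Hf; right; exact Hx.
    + intros x y z Hx Hy; apply Hd; right; assumption.
  - intros z Hz Hz'. apply in_flat_map in Hz' as [y [Hy Hzy]].
    apply Ha. rewrite (Hd a y z); auto; simpl; auto.
Qed.

Lemma length_flat_map_const {A B : Type} (f : A -> list B) (k : nat) (l : list A) :
  (forall x, In x l -> length (f x) = k) -> length (flat_map f l) = k * length l.
Proof.
  induction l as [|a l IH]; intros Hk; simpl; [lia|].
  rewrite length_app, IH, Hk; simpl; auto; [lia|].
  intros x Hx; apply Hk; right; exact Hx.
Qed.

(** Decreasing, because the machine loops count down to 0 and have to emit the clique edges in
    exactly this order. *)
Fixpoint down (k : nat) : list nat :=
  match k with O => [] | S k' => k' :: down k' end.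

Lemma in_down k x : In x (down k) <-> x < k.
Proof. induction k as [|k IH]; simpl; [|rewrite IH]; lia. Qed.

Lemma NoDup_down k : NoDup (down k).
Proof.
  induction k as [|k IH]; simpl; constructor; auto. rewrite in_down; lia.
Qed.

Lemma length_down k : length (down k) = k.
Proof. induction k; simpl; auto. Qed.

(* The node [(x, y)] of the part [X_i], for [i < 4] and [x, y < n]. *)
Definition node (n i x y : nat) : nat := (i * n + x) * n + y.

Definition perms (e : nat * nat * nat) : list (nat * nat * nat) :=
  match e with (a, b, c) =>
    [(a, b, c); (a, c, b); (b, a, c); (b, c, a); (c, a, b); (c, b, a)]
  end.

(** The edge from the last part back to part 0 is listed from its end in part 0, as [valid_graph]
    wants the smaller end first. *)
Definition cross (n : nat) (e : nat * nat * nat) : list (nat * nat) :=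
  match e with (x, y, z) =>
    [(node n 0 x y, node n 1 y z); (node n 1 x y, node n 2 y z);
     (node n 2 x y, node n 3 y z); (node n 0 y z, node n 3 x y)]
  end.

(** [q] stands for [i * n + x], a part together with a first entry; it names one clique, and
    [q * n + y] is then a node. *)
Definition cliques (n : nat) : list (nat * nat) :=
  flat_map (fun q =>
    flat_map (fun y => map (fun x => (q * n + x, q * n + y)) (down y)) (down n))
    (down (4 * n)).

Definition graph_of (H : hypergraph) : graph :=
  (4 * (fst H * fst H),
   flat_map (fun e => flat_map (cross (fst H)) (perms e)) (snd H) ++ cliques (fst H)).

Lemma mul_add_inj n q x q' x' :
  x < n -> x' < n -> q * n + x = q' * n + x' -> q = q' /\ x = x'.
Proof.
  intros Hx Hx' E.
  assert (Hd : forall p y, y < n -> p = (p * n + y) / n)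
    by (intros p y Hy; apply Nat.div_unique with (r := y); lia).
  assert (q = q') by (rewrite (Hd q x), (Hd q' x'), E; auto).
  subst; lia.
Qed.

Lemma node_inj n i x y j x' y' :
  x < n -> y < n -> x' < n -> y' < n ->
  node n i x y = node n j x' y' -> i = j /\ x = x' /\ y = y'.
Proof.
  unfold node; intros Hx Hy Hx' Hy' E.
  apply mul_add_inj in E as [E ->]; auto.
  apply mul_add_inj in E as [-> ->]; auto.
Qed.

Lemma node_lt n i x y j x' y' :
  x < n -> y < n -> x' < n -> y' < n -> i < j -> node n i x y < node n j x' y'.
Proof.
  unfold node; intros.
  assert ((i * n + x) + 1 <= j * n) by nia. nia.
Qed.

Lemma node_bound n i x y :
  i < 4 -> x < n -> y < n -> node n i x y < 4 * (n * n).
Proof. unfold node; intros. assert (i * n + x + 1 <= 4 * n) by nia. nia. Qed.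

Lemma hedge_perms H x y z :
  hedge H x y z <-> exists e, In e (snd H) /\ In (x, y, z) (perms e).
Proof.
  split.
  - intros (a & b & c & Hin & Hp). exists (a, b, c); split; auto.
    apply Permutation_sym in Hp.
    assert (Hx : In x [a; b; c]) by (apply (Permutation_in _ Hp); simpl; auto).
    destruct Hx as [<-|[<-|[<-|[]]]].
    + apply Permutation_cons_inv, Permutation_length_2 in Hp as [[-> ->]|[-> ->]]; simpl; auto.
    + apply Permutation_trans with (l'' := [b; a; c]) in Hp; [|constructor].
      apply Permutation_cons_inv, Permutation_length_2 in Hp as [[-> ->]|[-> ->]]; simpl; auto.
    + apply Permutation_trans with (l'' := [c; a; b]) in Hp;
        [|apply Permutation_sym, (Permutation_cons_append [a; b] c)].
      apply Permutation_cons_inv, Permutation_length_2 in Hp as [[-> ->]|[-> ->]]; simpl; tauto.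
  - intros ([[a b] c] & Hin & Hp). exists a, b, c; split; auto.
    simpl in Hp.
    destruct Hp as [E|[E|[E|[E|[E|[E|[]]]]]]]; inversion E; subst.
    + apply Permutation_refl.
    + apply perm_skip, perm_swap.
    + apply perm_swap.
    + apply (Permutation_cons_append [x; y] z).
    + apply Permutation_sym, (Permutation_cons_append [y; z] x).
    + apply (Permutation_rev [z; y; x]).
Qed.

Lemma hedge_valid H x y z :
  valid_hypergraph H -> hedge H x y z ->
  (x < fst H /\ y < fst H /\ z < fst H) /\ (x <> y /\ y <> z /\ x <> z).
Proof.
  intros [_ Hv] Hh. apply hedge_perms in Hh as ([[a b] c] & Hin & Hp).
  apply Hv in Hin. simpl in Hp.
  destruct Hp as [E|[E|[E|[E|[E|[E|[]]]]]]]; inversion E; subst; lia.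
Qed.

Lemma hedge_rot H x y z : hedge H x y z -> hedge H y z x.
Proof.
  intros (a & b & c & Hin & Hp). exists a, b, c; split; auto.
  exact (Permutation_trans Hp (Permutation_cons_append [y; z] x)).
Qed.

Definition succ4 (i : nat) : nat := if Nat.eqb i 3 then 0 else S i.

(** The indices are [node] terms, so that case analysis on an edge exhibits the coordinates of both
    ends, and [node_inj] matches them along a path. *)
Inductive clique_rel (n : nat) : nat -> nat -> Prop :=
| Clique_rel i x y y' : i < 4 -> x < n -> y < n -> y' < n -> y <> y' ->
    clique_rel n (node n i x y) (node n i x y').

Inductive next_rel (H : hypergraph) : nat -> nat -> Prop :=
| Next_rel i x y z : i < 4 -> hedge H x y z ->
    next_rel H (node (fst H) i x y) (node (fst H) (succ4 i) y z).

Lemma in_cliques n u v :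
  In (u, v) (cliques n) <->
  exists i x y y', i < 4 /\ x < n /\ y < y' /\ y' < n /\
    u = node n i x y /\ v = node n i x y'.
Proof.
  unfold cliques, node. split.
  - intros Hin. apply in_flat_map in Hin as (q & Hq & Hin).
    apply in_flat_map in Hin as (y' & Hy' & Hin).
    apply in_map_iff in Hin as (y & E & Hy). inversion E; subst.
    rewrite in_down in *. assert (n <> 0) by lia.
    exists (q / n), (q mod n), y, y'.
    pose proof (Nat.div_mod_eq q n).
    repeat split; auto; try (f_equal; f_equal; lia).
    + apply Nat.Div0.div_lt_upper_bound; lia.
    + apply Nat.mod_upper_bound; auto.
  - intros (i & x & y & y' & Hi & Hx & Hy & Hy' & -> & ->).
    apply in_flat_map. exists (i * n + x). rewrite in_down. split; [nia|].
    apply in_flat_map. exists y'. rewrite in_down. split; auto.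
    apply in_map_iff. exists y. rewrite in_down. auto.
Qed.

Lemma adj_graph_of H u v :
  valid_hypergraph H ->
  (adj (graph_of H) u v <->
   clique_rel (fst H) u v \/ next_rel H u v \/ next_rel H v u).
Proof.
  intros HV. unfold adj, graph_of; simpl snd. rewrite !in_app_iff.
  assert (Hcl : forall u v, In (u, v) (cliques (fst H)) ->
            clique_rel (fst H) u v /\ clique_rel (fst H) v u).
  { intros u' v' Hin. apply in_cliques in Hin as (i & x & y & y' & ? & ? & ? & ? & -> & ->).
    split; constructor; lia. }
  assert (Hcr : forall u v,
     In (u, v) (flat_map (fun e => flat_map (cross (fst H)) (perms e)) (snd H)) ->
     next_rel H u v \/ next_rel H v u).
  { intros u' v' Hin. apply in_flat_map in Hin as (e & He & Hin).
    apply in_flat_map in Hin as ([[x y] z] & Hp & Hin).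
    assert (Hh : hedge H x y z) by (apply hedge_perms; eauto).
    destruct Hin as [E|[E|[E|[E|[]]]]]; inversion E; subst.
    - left. apply (Next_rel H 0); auto.
    - left. apply (Next_rel H 1); auto.
    - left. apply (Next_rel H 2); auto.
    - right. apply (Next_rel H 3); auto. }
  assert (Hnx : forall u v, next_rel H u v ->
     let l := flat_map (fun e => flat_map (cross (fst H)) (perms e)) (snd H) in
     In (u, v) l \/ In (v, u) l).
  { intros u' v' [i x y z Hi Hh]. apply hedge_perms in Hh as (e & He & Hp).
    assert (forall w, In w (cross (fst H) (x, y, z)) ->
      In w (flat_map (fun e => flat_map (cross (fst H)) (perms e)) (snd H))) as Hw.
    { intros w Hw. apply in_flat_map; exists e; split; auto.
      apply in_flat_map; eauto. }
    destruct i as [|[|[|[|i]]]]; [left|left|left|right|lia]; apply Hw; simpl; auto. }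
  split.
  - intros [[Hin|Hin]|[Hin|Hin]].
    + apply Hcr in Hin; tauto.
    + apply Hcl in Hin; tauto.
    + apply Hcr in Hin; tauto.
    + apply Hcl in Hin; tauto.
  - intros [Hc|[Hn|Hn]].
    + destruct Hc as [i x y y' Hi Hx Hy Hy' Hne].
      assert (y < y' \/ y' < y) as [Hlt|Hlt] by lia; [left|right]; right;
        apply in_cliques; do 4 eexists; repeat split; eauto.
    + apply Hnx in Hn; simpl in Hn; tauto.
    + apply Hnx in Hn; simpl in Hn; tauto.
Qed.

(** The parts of the two ends tell which of the four edges it is, and their coordinates spell the
    triple. This keeps edges from being listed twice. *)
Lemma cross_inj n e e' p :
  (match e with (x, y, z) => x < n /\ y < n /\ z < n end) ->
  (match e' with (x, y, z) => x < n /\ y < n /\ z < n end) ->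
  In p (cross n e) -> In p (cross n e') -> e = e'.
Proof.
  destruct e as [[x y] z], e' as [[x' y'] z']; intros Hb Hb' Hp Hp'. simpl in Hp, Hp'.
  destruct Hp as [<-|[<-|[<-|[<-|[]]]]]; destruct Hp' as [E|[E|[E|[E|[]]]]];
    injection E as E1 E2; apply node_inj in E1, E2; try lia;
    repeat f_equal; lia.
Qed.

Lemma perms_bound H e x y z :
  valid_hypergraph H -> In e (snd H) -> In (x, y, z) (perms e) ->
  x < fst H /\ y < fst H /\ z < fst H.
Proof.
  intros HV He Hp. apply (hedge_valid H x y z); auto. apply hedge_perms; eauto.
Qed.

Lemma valid_graph_of H : valid_hypergraph H -> valid_graph (graph_of H).
Proof.
  intros HV. pose proof HV as [Hnd Hlt]. split.
  - simpl snd. apply NoDup_app.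
    + apply NoDup_flat_map; auto.
      * intros [[a b] c] Hin. pose proof (Hlt _ _ _ Hin).
        apply NoDup_flat_map.
        -- simpl. repeat constructor; simpl; intros HH;
             repeat (destruct HH as [E|HH]; [injection E; lia|]); exact HH.
        -- intros [[x y] z] Hp. apply (perms_bound H) in Hp as Hb; auto.
           simpl. repeat constructor; simpl; intros HH;
             repeat (destruct HH as [E|HH];
               [injection E as E1 E2; apply node_inj in E1, E2; lia|]); exact HH.
        -- intros [[x y] z] [[x' y'] z'] p Hp Hp'.
           apply cross_inj; apply (perms_bound H (a, b, c)); auto.
      * intros [[a b] c] [[a' b'] c'] p Hin Hin' Hp Hp'.
        apply in_flat_map in Hp as ([[x y] z] & Hpe & Hp).
        apply in_flat_map in Hp' as ([[x' y'] z'] & Hpe' & Hp').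
        assert (E : (x, y, z) = (x', y', z')).
        { refine (cross_inj (fst H) _ _ p _ _ Hp Hp');
            [apply (perms_bound H (a, b, c))|apply (perms_bound H (a', b', c'))]; auto. }
        (* Both hyperedges are reorderings of one triple and are stored increasingly, hence they are
           equal. *)
        injection E as <- <- <-. apply Hlt in Hin, Hin'. simpl in Hpe, Hpe'.
        destruct Hpe as [E|[E|[E|[E|[E|[E|[]]]]]]]; injection E as -> -> ->;
        destruct Hpe' as [E|[E|[E|[E|[E|[E|[]]]]]]]; injection E as -> -> ->; auto; lia.
    + apply NoDup_flat_map; [apply NoDup_down| |].
      * intros q _. apply NoDup_flat_map; [apply NoDup_down| |].
        -- intros y _. apply NoDup_map_NoDup_ForallPairs; [|apply NoDup_down].
           intros x x' _ _ E. injection E; lia.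
        -- intros y y' p _ _ Hp Hp'. apply in_map_iff in Hp as (x & <- & _).
           apply in_map_iff in Hp' as (x' & E & _). injection E; lia.
      * intros q q' p _ _ Hp Hp'.
        apply in_flat_map in Hp as (y & Hy & Hp).
        apply in_flat_map in Hp' as (y' & Hy' & Hp').
        apply in_map_iff in Hp as (x & <- & _).
        apply in_map_iff in Hp' as (x' & E & _). injection E as _ E.
        rewrite in_down in *. apply mul_add_inj in E as [-> _]; auto.
    (* A clique edge stays within a part, a cross edge leaves it. *)
    + intros [u v] Hin Hc.
      apply in_cliques in Hc as (i & x & y & y' & Hi & Hx & Hy & Hy' & -> & ->).
      apply in_flat_map in Hin as (e & He & Hin).
      apply in_flat_map in Hin as ([[x1 y1] z1] & Hp & Hin).
      apply (perms_bound H) in Hp; auto.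
      destruct Hin as [E|[E|[E|[E|[]]]]]; injection E as E1 E2;
        apply node_inj in E1, E2; lia.
  - intros u v Hin. simpl in Hin. simpl fst. rewrite in_app_iff in Hin.
    destruct Hin as [Hin|Hin].
    + apply in_flat_map in Hin as (e & He & Hin).
      apply in_flat_map in Hin as ([[x y] z] & Hp & Hin).
      apply (perms_bound H) in Hp; auto.
      destruct Hin as [E|[E|[E|[E|[]]]]]; injection E as <- <-; split;
        try apply node_lt; try apply node_bound; lia.
    + apply in_cliques in Hin as (i & x & y & y' & Hi & Hx & Hy & Hy' & -> & ->).
      split; [unfold node; lia|apply node_bound; lia].
Qed.

Lemma length_triangle n (f : nat -> nat -> nat * nat) :
  2 * length (flat_map (fun y => map (f y) (down y)) (down n)) = n * (n - 1).
Proof.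
  induction n as [|n IH]; [reflexivity|]. simpl flat_map.
  rewrite length_app, length_map, length_down. nia.
Qed.

(** A hyperedge has 6 orderings with 4 edges each, and there are [4 n] cliques of [n (n - 1) / 2]
    edges. *)
Lemma gm_graph_of H :
  gm (graph_of H) = 24 * length (snd H) + 2 * fst H * fst H * (fst H - 1).
Proof.
  unfold gm; simpl snd. rewrite length_app.
  rewrite (length_flat_map_const _ 24); [|intros [[a b] c] _; reflexivity].
  unfold cliques.
  assert (Hk : forall q, length (flat_map (fun y =>
      map (fun x => (q * fst H + x, q * fst H + y)) (down y)) (down (fst H)))
      = (fst H * (fst H - 1)) / 2).
  { intros q. rewrite <- (length_triangle (fst H) (fun y x => (q * fst H + x, q * fst H + y))).
    rewrite (Nat.mul_comm 2), Nat.div_mul; auto. }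
  rewrite (length_flat_map_const _ (fst H * (fst H - 1) / 2)); auto.
  rewrite length_down, <- (Hk 0).
  pose proof (length_triangle (fst H) (fun y x => (0 * fst H + x, 0 * fst H + y))). nia.
Qed.

(* Around an induced 4-cycle record how the index [i] of the part [X_i] changes
   along each edge: 0 (inside a clique), +1 or -1.  The neighbours of a node in
   its own part, and those in the next part, form cliques, so neither 0,0 nor
   -1,+1 occurs consecutively; what remains is the constant sequences, which
   spell a hyperclique, and the rotations of +1,0,-1,0, which force two nodes
   to coincide. *)
Lemma induced_C4_graph_of H :
  valid_hypergraph H -> (has_induced_C4 (graph_of H) <-> has_4_hyperclique H).
Proof.
  intros HV.
  assert (Hsym : forall u v, adj (graph_of H) u v -> adj (graph_of H) v u)
    by (unfold adj; tauto).
  assert (Hdec : forall u v, adj (graph_of H) u v ->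
     clique_rel (fst H) u v \/ next_rel H u v \/ next_rel H v u)
    by (intros u v; apply adj_graph_of; auto).
  assert (Hcl : forall u v, clique_rel (fst H) u v -> adj (graph_of H) u v)
    by (intros u v Hc; apply adj_graph_of; auto).
  assert (Hcc : forall u v w, clique_rel (fst H) u v -> clique_rel (fst H) v w ->
            u <> w -> ~ adj (graph_of H) u w -> False).
  { intros u v w [i x y y' Hi Hx Hy Hy' Hne] Hvw Huw Hn. apply Hn, Hcl.
    remember (node (fst H) i x y') as v' eqn:Ev.
    destruct Hvw as [i2 x2 y2 y3 ? ? ? ? ?].
    apply node_inj in Ev as (-> & -> & ->); auto.
    constructor; auto; intros ->; auto. }
  (* Excludes -1,+1: [u] and [w] both have the second entry of [v] as first entry. *)
  assert (Hnn : forall u v w, next_rel H v u -> next_rel H v w ->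
            u <> w -> ~ adj (graph_of H) u w -> False).
  { intros u v w [i x y z Hi Hh] Hvw Huw Hn. apply Hn, Hcl.
    remember (node (fst H) i x y) as v' eqn:Ev.
    destruct Hvw as [i2 x2 y2 z2 Hi2 Hh2].
    apply hedge_valid in Hh as [? _]; auto. apply hedge_valid in Hh2 as [? _]; auto.
    apply node_inj in Ev as (-> & -> & ->); try tauto.
    constructor; try tauto.
    - unfold succ4; destruct (Nat.eqb_spec i 3); lia.
    - intros ->; auto. }
  (* Excludes +1,0,-1,0: the first entry shared by [b] and [c] is the second entry of both [a] and
     [d], which lie in one clique and so would coincide. *)
  assert (Hrect : forall a b c d, next_rel H a b -> clique_rel (fst H) b c ->
            next_rel H d c -> clique_rel (fst H) d a -> False).
  { intros a b c d Hab Hbc Hdc Hda.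
    destruct Hab as [i x y z Hi Hh]. destruct Hdc as [i2 x2 y2 z2 Hi2 Hh2].
    apply hedge_valid in Hh as [? _]; auto. apply hedge_valid in Hh2 as [? _]; auto.
    remember (node (fst H) (succ4 i) y z) as b eqn:Eb.
    remember (node (fst H) (succ4 i2) y2 z2) as c eqn:Ec.
    destruct Hbc as [j u v v'].
    apply node_inj in Eb as (-> & -> & ->); try tauto.
    apply node_inj in Ec as (Ei & -> & ->); try tauto.
    remember (node (fst H) i x y2) as a eqn:Ea.
    remember (node (fst H) i2 x2 y2) as d eqn:Ed.
    destruct Hda as [j1 u1 w1 w1'].
    apply node_inj in Ea as (-> & -> & ->); try tauto.
    apply node_inj in Ed as (-> & -> & ->); try tauto. }
  set (part := fun u => u / (fst H * fst H)).
  assert (Hpn : forall i x y, x < fst H -> y < fst H -> part (node (fst H) i x y) = i).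
  { intros i x y Hx Hy. unfold part, node. symmetry.
    apply Nat.div_unique with (r := x * fst H + y); nia. }
  assert (Hpc : forall u v, clique_rel (fst H) u v -> part u = part v /\ part u < 4).
  { intros u v [i x y y']. rewrite !Hpn; auto. }
  assert (Hpx : forall u v, next_rel H u v ->
            part v = succ4 (part u) /\ part u < 4).
  { intros u v [i x y z Hi Hh]. apply hedge_valid in Hh as [? _]; auto.
    rewrite !Hpn; tauto. }
  (* Each edge shifts the pair by one entry, so the nodes read [(x, y)], [(y, z)], [(z, w)],
     [(w, x)] and the edges are the four triples of [x, y, z, w]; here [w] is [z2]. *)
  assert (Hcyc : forall a b c d, next_rel H a b -> next_rel H b c -> next_rel H c d ->
            next_rel H d a -> has_4_hyperclique H).
  { intros a b c d Hab Hbc Hcd Hda.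
    destruct Hab as [i x y z Hi Hh]. pose proof (hedge_valid _ _ _ _ HV Hh) as Hb.
    remember (node (fst H) (succ4 i) y z) as b eqn:Eb.
    destruct Hbc as [i2 x2 y2 z2 Hi2 Hh2]. pose proof (hedge_valid _ _ _ _ HV Hh2) as Hb2.
    apply node_inj in Eb as (_ & -> & ->); try tauto.
    remember (node (fst H) (succ4 i2) z z2) as c eqn:Ec.
    destruct Hcd as [i3 x3 y3 z3 Hi3 Hh3]. pose proof (hedge_valid _ _ _ _ HV Hh3) as Hb3.
    apply node_inj in Ec as (_ & -> & ->); try tauto.
    remember (node (fst H) (succ4 i3) z2 z3) as d eqn:Ed.
    remember (node (fst H) i x y) as a eqn:Ea.
    destruct Hda as [i4 x4 y4 z4 Hi4 Hh4]. pose proof (hedge_valid _ _ _ _ HV Hh4) as Hb4.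
    apply node_inj in Ed as (_ & -> & ->); try tauto.
    apply node_inj in Ea as (_ & -> & ->); try tauto.
    exists x, y, z, z2. split.
    - assert (x <> z2) by (intros ->; tauto). assert (y <> z2) by (intros ->; tauto).
      repeat constructor; simpl; intuition congruence.
    - split; [exact Hh|]. split; [apply hedge_rot; exact Hh4|].
      split; [|exact Hh2]. apply hedge_rot, hedge_rot; exact Hh3. }
  split.
  - intros (a & b & c & d & Hnd & Hab & Hbc & Hcd & Hda & Hac & Hbd).
    assert (a <> c /\ b <> d) as [Nac Nbd].
    { inversion Hnd; inversion H3; subst; simpl in *; split; intros ->; tauto. }
    assert (Hcs : forall u v, clique_rel (fst H) u v -> clique_rel (fst H) v u)
      by (intros u v [i x y y']; constructor; auto).
    assert (Hca : ~ adj (graph_of H) c a) by auto.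
    assert (Hdb : ~ adj (graph_of H) d b) by auto.
    (* Disposes of the patterns with exactly one 0, and of +1,0,+1,0 and -1,0,-1,0: the index
       changes by 1, 2 or 3 modulo 4 around the cycle, which therefore cannot close. *)
    assert (Hs : forall i, i < 4 -> succ4 i <> i /\ succ4 (succ4 i) <> i
                /\ succ4 (succ4 (succ4 i)) <> i).
    { intros [|[|[|[|i]]]] Hi; unfold succ4; simpl; lia. }
    destruct (Hdec _ _ Hab) as [A|[A|A]]; destruct (Hdec _ _ Hbc) as [B|[B|B]];
      try (exfalso; eauto using not_eq_sym; fail);
    destruct (Hdec _ _ Hcd) as [C|[C|C]];
      try (exfalso; eauto using not_eq_sym; fail);
    destruct (Hdec _ _ Hda) as [D|[D|D]];
      try (exfalso; eauto using not_eq_sym; fail);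
      try (eapply Hcyc; eauto; fail).
    all: try (exfalso;
      repeat match goal with
      | X : clique_rel _ _ _ |- _ => apply Hpc in X as [? ?]
      | X : next_rel _ _ _ |- _ => apply Hpx in X as [? ?] end;
      pose proof (Hs (part a)); pose proof (Hs (part b));
      pose proof (Hs (part c)); pose proof (Hs (part d)); intuition congruence).
  - intros (x & y & z & w & Hnd & Hxyz & Hxyw & Hxzw & Hyzw).
    pose proof (hedge_valid _ _ _ _ HV Hxyz) as Hb.
    pose proof (hedge_valid _ _ _ _ HV Hxyw) as Hb'.
    exists (node (fst H) 0 x y), (node (fst H) 1 y z), (node (fst H) 2 z w), (node (fst H) 3 w x).
    assert (Hne : forall i x y j x' y', x < fst H -> y < fst H -> x' < fst H -> y' < fst H ->
       i <> j -> node (fst H) i x y <> node (fst H) j x' y').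
    { intros i x1 y1 j x1' y1' ? ? ? ? Hij E. apply node_inj in E; tauto. }
    (* Opposite nodes lie two parts apart, and no edge spans two parts. *)
    assert (Hop : forall i x y j x' y', x < fst H -> y < fst H -> x' < fst H -> y' < fst H ->
       i < 4 -> j = S (S i) -> ~ adj (graph_of H) (node (fst H) i x y) (node (fst H) j x' y')).
    { intros i x1 y1 j x1' y1' ? ? ? ? Hij -> E. apply Hdec in E as [E|[E|E]].
      - apply Hpc in E. rewrite !Hpn in E; lia.
      - apply Hpx in E. rewrite !Hpn in E; auto. unfold succ4 in E.
        destruct (Nat.eqb_spec i 3); lia.
      - apply Hpx in E. rewrite !Hpn in E; auto. unfold succ4 in E.
        destruct (Nat.eqb_spec (S (S i)) 3); lia. }
    split; [|repeat split].
    + repeat constructor; simpl; intros HH;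
        repeat (destruct HH as [HH|HH]; [revert HH; apply Hne; lia|]); exact HH.
    + apply adj_graph_of; auto. right; left. apply (Next_rel H 0); auto.
    + apply adj_graph_of; auto. right; left. apply (Next_rel H 1); auto.
    + apply adj_graph_of; auto. right; left. apply (Next_rel H 2); auto.
      apply hedge_rot; auto.
    + apply adj_graph_of; auto. right; left. apply (Next_rel H 3); auto.
      apply hedge_rot, hedge_rot; auto.
    + apply Hop; lia.
    + apply Hop; lia.
Qed.

(** * Structured programs and simulation on the word-RAM *)

Lemma exec_Halted w p t b : exec w p t (Halted b) = Halted b.
Proof. destruct t; reflexivity. Qed.

Lemma exec_add w p s t r : exec w p (s + t) r = exec w p t (exec w p s r).
Proof.
  revert r; induction s as [|s IH]; intros r; simpl; auto.
  destruct r as [pc m|b]; [apply IH|rewrite exec_Halted; reflexivity].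
Qed.

Lemma exec_1 w p pc m : exec w p 1 (Running pc m) = step w p pc m.
Proof. reflexivity. Qed.

(** * Compiling structured programs to jumps *)

Definition code_at (p : program) (off : nat) (l : list instr) : Prop :=
  forall i ins, nth_error l i = Some ins -> nth_error p (off + i) = Some ins.

Lemma code_at_app p off l1 l2 :
  code_at p off (l1 ++ l2) -> code_at p off l1 /\ code_at p (off + length l1) l2.
Proof.
  intros Hc; split; intros i ins Hi.
  - apply Hc. rewrite nth_error_app1; auto. apply nth_error_Some. congruence.
  - rewrite <- Nat.add_assoc. apply Hc. rewrite nth_error_app2; [|lia].
    rewrite <- Hi. f_equal; lia.
Qed.

Lemma code_at_cons p off i l :
  code_at p off (i :: l) -> nth_error p off = Some i /\ code_at p (S off) l.
Proof.
  intros Hc. apply (code_at_app p off [i] l) in Hc as [H1 H2]. split.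
  - rewrite <- (Nat.add_0_r off). apply H1; reflexivity.
  - rewrite Nat.add_1_r in H2; exact H2.
Qed.

Inductive com : Type :=
| Block (l : list instr)
| Seq (c1 c2 : com)
| While (r : nat) (c : com).

Declare Scope com_scope.
Notation "c1 ;; c2" := (Seq c1 c2) (at level 100, right associativity) : com_scope.
Open Scope com_scope.

Definition straight (i : instr) : Prop :=
  match i with IJmp _ | IJz _ _ | IHalt _ => False | _ => True end.

Definition eff (w : nat) (m : nat -> nat) (i : instr) : nat -> nat :=
  match i with
  | IConst d k => upd w m d k
  | IBin o d a b => upd w m d (binop_eval o (m a) (m b))
  | ILoad d a => upd w m d (m (m a))
  | IStore a s => upd w m (m a) (m s)
  | _ => m
  end.

Definition effs (w : nat) (l : list instr) (m : nat -> nat) : nat -> nat :=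
  fold_left (eff w) l m.

(** Jump targets are absolute, hence the offset. A loop exits behind its closing [IJmp], which
    accounts for the 2. *)
Fixpoint compile (off : nat) (c : com) : list instr :=
  match c with
  | Block l => l
  | Seq c1 c2 => let l1 := compile off c1 in l1 ++ compile (off + length l1) c2
  | While r c =>
      let l := compile (S off) c in IJz r (off + length l + 2) :: l ++ [IJmp off]
  end.

(** The number counts machine steps exactly: an iteration adds 2, for [IJz] and [IJmp], and leaving
    the loop costs one [IJz]. *)
Inductive run (w : nat) : com -> (nat -> nat) -> nat -> (nat -> nat) -> Prop :=
| run_block l m : Forall straight l -> run w (Block l) m (length l) (effs w l m)
| run_seq c1 c2 m t1 m1 t2 m2 :
    run w c1 m t1 m1 -> run w c2 m1 t2 m2 -> run w (c1 ;; c2) m (t1 + t2) m2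
| run_while_stop r c m : m r = 0 -> run w (While r c) m 1 m
| run_while_loop r c m t1 m1 t2 m2 :
    m r <> 0 -> run w c m t1 m1 -> run w (While r c) m1 t2 m2 ->
    run w (While r c) m (t1 + t2 + 2) m2.

Lemma step_straight w p pc m i :
  nth_error p pc = Some i -> straight i -> step w p pc m = Running (S pc) (eff w m i).
Proof. intros E Hs. unfold step; rewrite E. destruct i; simpl in *; tauto. Qed.

Lemma exec_block w p l off m :
  Forall straight l -> code_at p off l ->
  exec w p (length l) (Running off m) = Running (off + length l) (effs w l m).
Proof.
  intros Hs; revert off m; induction Hs as [|i l Hi Hl IH]; intros off m Hc; simpl.
  - rewrite Nat.add_0_r; reflexivity.
  - apply code_at_cons in Hc as [H1 H2].
    rewrite (step_straight w p off m i H1 Hi), IH; auto. f_equal; lia.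
Qed.

Lemma exec_compile w p c m t m' :
  run w c m t m' -> forall off, code_at p off (compile off c) ->
  exec w p t (Running off m) = Running (off + length (compile off c)) m'.
Proof.
  induction 1 as [l m Hs|c1 c2 m t1 m1 t2 m2 _ IH1 _ IH2|r c m Hr
                 |r c m t1 m1 t2 m2 Hr _ IH1 _ IH2]; intros off Hc; simpl in *.
  - apply exec_block; auto.
  - apply code_at_app in Hc as [H1 H2].
    rewrite exec_add, IH1, IH2, length_app, Nat.add_assoc; auto.
  - apply code_at_cons in Hc as [H1 _]. unfold step. rewrite H1, Hr. simpl.
    f_equal. rewrite length_app; simpl; lia.
  - pose proof Hc as Hc'. apply code_at_cons in Hc as [H1 H2].
    apply code_at_app in H2 as [H2 H3]. apply code_at_cons in H3 as [H3 _].
    replace (t1 + t2 + 2) with (1 + (t1 + (1 + t2))) by lia.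
    rewrite exec_add, exec_1. unfold step at 1. rewrite H1.
    destruct (Nat.eqb_spec (m r) 0) as [E|_]; [contradiction|].
    rewrite exec_add, IH1, exec_add, exec_1; auto.
    unfold step at 1. rewrite H3. apply IH2; auto.
Qed.

(** * Simulating a machine with smaller words *)

Lemma mod_pow_mod v a b : a <= b -> (v mod 2 ^ b) mod 2 ^ a = v mod 2 ^ a.
Proof.
  intros Hab. replace b with (a + (b - a)) by lia.
  rewrite Nat.pow_add_r, Nat.Div0.mod_mul_r, (Nat.mul_comm (2 ^ a) (_ mod _)).
  rewrite Nat.Div0.mod_add, Nat.Div0.mod_mod; reflexivity.
Qed.

Lemma upd_eq w m d v : upd w m d v d = v mod 2 ^ w.
Proof. unfold upd; rewrite Nat.eqb_refl; reflexivity. Qed.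

Lemma upd_neq w m d v i : i <> d -> upd w m d v i = m i.
Proof. unfold upd; intros; destruct (Nat.eqb_spec i d); congruence. Qed.

Lemma pow2_pos w : 0 < 2 ^ w.
Proof. apply Nat.neq_0_lt_0, Nat.pow_nonzero; lia. Qed.

Lemma upd_lt w m d v i b : (i <> d -> m i < b) -> 2 ^ w <= b -> upd w m d v i < b.
Proof.
  intros Hm Hb. unfold upd; destruct (Nat.eqb_spec i d); auto.
  pose proof (pow2_pos w). pose proof (Nat.mod_upper_bound v (2 ^ w)). lia.
Qed.

(* Cell [i] of the simulated machine lives in cell [24 + i].  Cell 17 holds
   2 ^ (simulated word size), cell 18 holds 24, cell 19 is scratch, and every
   instruction becomes three, so that jump targets scale. *)
Definition sim_instr (off : nat) (i : instr) : list instr :=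
  match i with
  | IConst d k => [IConst (24 + d) k; IBin OMod (24 + d) (24 + d) 17; IConst 19 0]
  | IBin o d a b => [IBin o 19 (24 + a) (24 + b); IBin OMod (24 + d) 19 17; IConst 19 0]
  | ILoad d a => [IBin OAdd 19 (24 + a) 18; ILoad (24 + d) 19; IConst 19 0]
  | IStore a s => [IBin OAdd 19 (24 + a) 18; IStore 19 (24 + s); IConst 19 0]
  | IJmp t => [IJmp (off + 3 * t); IConst 19 0; IConst 19 0]
  | IJz a t => [IJz (24 + a) (off + 3 * t); IConst 19 0; IConst 19 0]
  | IHalt a => [IHalt (24 + a); IConst 19 0; IConst 19 0]
  end.

Definition sim (off : nat) (p : program) : program := flat_map (sim_instr off) p.

Lemma length_sim off p : length (sim off p) = 3 * length p.
Proof. apply length_flat_map_const. intros [] _; reflexivity. Qed.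

(** The place [off0] of the code is kept apart from the base [off] of the jump targets, as only the
    former moves in the induction. *)
Lemma code_at_sim q off0 off p pc i :
  code_at q off0 (sim off p) -> nth_error p pc = Some i ->
  code_at q (off0 + 3 * pc) (sim_instr off i).
Proof.
  revert off0 pc; induction p as [|i' p IH]; intros off0 pc Hc Hi;
    [destruct pc; discriminate|].
  apply code_at_app in Hc as [H1 H2].
  destruct pc as [|pc]; simpl in Hi.
  - injection Hi as ->. rewrite Nat.add_0_r; exact H1.
  - assert (E : length (sim_instr off i') = 3) by (destruct i'; reflexivity).
    rewrite E in H2. replace (off0 + 3 * S pc) with (off0 + 3 + 3 * pc) by lia.
    apply IH; auto.
Qed.

Definition direct (i : instr) : list nat :=
  match i with
  | IConst d _ => [d] | IBin _ d a b => [d; a; b] | ILoad d a => [d; a]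
  | IStore a s => [a; s] | IJmp _ => [] | IJz a _ => [a] | IHalt a => [a]
  end.

(** Agreement below [lim] is enough: indirect addresses are words below [2 ^ wg], direct ones are
    bounded by [Hdir], so with [2 ^ wg <= lim] no other simulated cell is accessed. *)
Definition simulates (wg lim : nat) (v m : nat -> nat) : Prop :=
  (forall i, v i < 2 ^ wg) /\ (forall i, i < lim -> m (24 + i) = v i) /\
  m 17 = 2 ^ wg /\ m 18 = 24.

Section Simulation.

Variables (w wg lim off : nat) (p q : program).
Hypothesis Hwg : wg < w.
Hypothesis Hlim : 2 ^ wg <= lim.
Hypothesis Hlim' : 24 + lim <= 2 ^ w.
Hypothesis Hdir : forall i a, In i p -> In a (direct i) -> a < lim.
Hypothesis Hcode : code_at q off (sim off p).
Hypothesis Hlen : length q = off + 3 * length p.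

Lemma simulates_write v m m' d x :
  simulates wg lim v m ->
  (forall i, i <> 19 -> i <> 24 + d -> m' i = m i) -> m' (24 + d) = x mod 2 ^ wg ->
  simulates wg lim (upd wg v d x) m'.
Proof.
  intros (H1 & H2 & H3 & H4) Hf Hd. repeat split.
  - intros i. apply upd_lt; auto.
  - intros i Hi. unfold upd. destruct (Nat.eqb_spec i d) as [->|Hne]; auto.
    rewrite Hf; auto; lia.
  - rewrite Hf; auto; lia.
  - rewrite Hf; auto; lia.
Qed.

Lemma exec_3 pc m i1 i2 i3 :
  code_at q pc [i1; i2; i3] -> straight i1 -> straight i2 -> straight i3 ->
  exec w q 3 (Running pc m) = Running (pc + 3) (effs w [i1; i2; i3] m).
Proof. intros Hc H1 H2 H3. apply (exec_block w q [i1; i2; i3]); auto. Qed.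

Lemma simulate_step pc v m :
  simulates wg lim v m ->
  exists t, t <= 3 /\
  match step wg p pc v with
  | Halted b => exec w q t (Running (off + 3 * pc) m) = Halted b
  | Running pc' v' => exists m',
      exec w q t (Running (off + 3 * pc) m) = Running (off + 3 * pc') m' /\
      simulates wg lim v' m'
  end.
Proof.
  intros HS. pose proof HS as (H1 & H2 & H3 & H4).
  destruct (nth_error p pc) as [i|] eqn:Ei.
  (* The simulated code ends [q] by [Hlen], so running off the end of [p] becomes running off the
     end of [q]. *)
  2:{ exists 1. split; [lia|]. unfold step at 1. rewrite Ei, exec_1. unfold step.
      apply nth_error_None in Ei.
      replace (nth_error q (off + 3 * pc)) with (@None instr); auto.
      symmetry; apply nth_error_None; lia. }
  pose proof (code_at_sim _ _ _ _ _ _ Hcode Ei) as Hc.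
  assert (Ha : forall a, In a (direct i) -> a < lim)
    by (intros a; apply Hdir; eapply nth_error_In; eauto).
  unfold step at 1; rewrite Ei.
  assert (Hpw : 2 ^ wg < 2 ^ w) by (apply Nat.pow_lt_mono_r; lia).
  assert (E3 : off + 3 * S pc = off + 3 * pc + 3) by lia.
  assert (Haddr : forall a, In a (direct i) -> (m (24 + a) + m 18) mod 2 ^ w = 24 + v a).
  { intros a Hin. rewrite H4, H2, Nat.mod_small; auto; pose proof (H1 a); lia. }
  (* Simulated values are words already, so reducing them again, at width [w] or [wg], changes
     nothing. *)
  assert (Hval : forall a b, v a mod 2 ^ b = v a \/ b < wg).
  { intros a b. destruct (Nat.lt_ge_cases b wg); auto. left. apply Nat.mod_small.
    pose proof (H1 a). assert (2 ^ wg <= 2 ^ b) by (apply Nat.pow_le_mono_r; lia). lia. }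
  destruct i as [d k|o d a b|d a|a s|t|a t|a]; cbn [sim_instr] in Hc.
  - exists 3; split; auto. eexists; rewrite (exec_3 _ m _ _ _ Hc) by exact I.
    rewrite E3; split; [reflexivity|]. unfold effs; cbn [fold_left eff].
    apply (simulates_write v m); auto.
    + intros i Hi Hi'. rewrite !upd_neq; auto; lia.
    + rewrite (upd_neq _ _ 19), !upd_eq, (upd_neq _ _ _ _ 17), H3 by lia. cbn [binop_eval].
      rewrite (mod_pow_mod k) by lia. apply Nat.mod_small.
      pose proof (Nat.mod_upper_bound k (2 ^ wg)). pose proof (pow2_pos wg). lia.
  - exists 3; split; auto. eexists; rewrite (exec_3 _ m _ _ _ Hc) by exact I.
    rewrite E3; split; [reflexivity|]. unfold effs; cbn [fold_left eff].
    apply (simulates_write v m); auto.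
    + intros i Hi Hi'. rewrite !upd_neq; auto; lia.
    + rewrite (upd_neq _ _ 19), !upd_eq, (upd_neq _ _ _ _ 17), H3 by lia. cbn [binop_eval].
      rewrite (H2 a), (H2 b) by (apply Ha; simpl; auto).
      (* The intermediate reduction modulo [2 ^ w] is harmless because [2 ^ wg] divides [2 ^ w]. *)
      rewrite Nat.mod_small; [apply mod_pow_mod; lia|].
      pose proof (Nat.mod_upper_bound (binop_eval o (v a) (v b) mod 2 ^ w) (2 ^ wg)).
      pose proof (pow2_pos wg). lia.
  - exists 3; split; auto. eexists; rewrite (exec_3 _ m _ _ _ Hc) by exact I.
    rewrite E3; split; [reflexivity|]. unfold effs; cbn [fold_left eff].
    apply (simulates_write v m); auto.
    + intros i Hi Hi'. rewrite !upd_neq; auto; lia.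
    + rewrite (upd_neq _ _ 19), !upd_eq by lia. cbn [binop_eval]. rewrite Haddr by (simpl; auto).
      pose proof (H1 a). rewrite upd_neq, H2 by lia.
      destruct (Hval (v a) w), (Hval (v a) wg); try lia; congruence.
  - exists 3; split; auto. eexists; rewrite (exec_3 _ m _ _ _ Hc) by exact I.
    rewrite E3; split; [reflexivity|]. unfold effs; cbn [fold_left eff].
    apply (simulates_write v m); auto; rewrite ?upd_eq; cbn [binop_eval];
      rewrite Haddr by (simpl; auto).
    + intros i Hi Hi'. rewrite !upd_neq; auto; lia.
    + rewrite (upd_neq _ _ 19), upd_eq, upd_neq, H2 by (try (apply Ha; simpl; auto); lia).
      destruct (Hval s w), (Hval s wg); try lia; congruence.
  - exists 1; split; [lia|]. exists m; split; auto.
    rewrite exec_1. unfold step. apply code_at_cons in Hc as [Hc _]. rewrite Hc. reflexivity.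
  - apply code_at_cons in Hc as [Hc Hc2].
    assert (Ea : m (24 + a) = v a) by (apply H2, Ha; simpl; auto).
    destruct (Nat.eqb (v a) 0) eqn:E0.
    + exists 1; split; [lia|]. exists m; split; auto.
      rewrite exec_1. unfold step. rewrite Hc, Ea, E0. reflexivity.
    (* Falling through also runs the two padding instructions, which only touch the scratch cell
       19. *)
    + exists 3; split; auto. exists (effs w [IConst 19 0; IConst 19 0] m). split.
      * rewrite (exec_add w q 1 2), exec_1. unfold step. rewrite Hc, Ea, E0.
        rewrite (exec_block w q [IConst 19 0; IConst 19 0]); auto; [|repeat constructor].
        f_equal; cbn [length]; lia.
      * unfold effs; cbn [fold_left eff]. repeat split; auto; intros; rewrite !upd_neq; auto; lia.
  - exists 1; split; [lia|]. rewrite exec_1. unfold step.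
    apply code_at_cons in Hc as [Hc _]. rewrite Hc, H2; auto. apply Ha; simpl; auto.
Qed.

Lemma simulate_exec t b : forall pc v m,
  simulates wg lim v m -> exec wg p t (Running pc v) = Halted b ->
  exists t', t' <= 3 * t /\ exec w q t' (Running (off + 3 * pc) m) = Halted b.
Proof.
  induction t as [|t IH]; intros pc v m HS He; [discriminate|].
  simpl in He. destruct (simulate_step pc v m HS) as (t1 & Ht1 & Hs).
  destruct (step wg p pc v) as [pc' v'|b'].
  - destruct Hs as (m' & He' & HS').
    destruct (IH pc' v' m' HS' He) as (t2 & Ht2 & He2).
    exists (t1 + t2). split; [lia|]. rewrite exec_add, He'; exact He2.
  - rewrite exec_Halted in He. injection He as ->. exists t1; split; [lia|exact Hs].
Qed.

End Simulation.

(** * Writing the graph *)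

Definition hoare (w : nat) (P : (nat -> nat) -> Prop) (c : com) (T : nat)
  (Q : (nat -> nat) -> Prop) : Prop :=
  forall m, P m -> exists t m', t <= T /\ run w c m t m' /\ Q m'.

Lemma hoare_conseq w (P P' Q Q' : (nat -> nat) -> Prop) c T T' :
  hoare w P c T Q -> (forall m, P' m -> P m) -> (forall m, Q m -> Q' m) -> T <= T' ->
  hoare w P' c T' Q'.
Proof.
  intros H HP HQ HT m Hm. destruct (H m (HP m Hm)) as (t & m' & Ht & Hr & Hq).
  exists t, m'; repeat split; auto; lia.
Qed.

Lemma hoare_seq w P Q R c1 c2 T1 T2 :
  hoare w P c1 T1 Q -> hoare w Q c2 T2 R -> hoare w P (c1 ;; c2) (T1 + T2) R.
Proof.
  intros H1 H2 m Hm. destruct (H1 m Hm) as (t1 & m1 & Ht1 & Hr1 & Hq1).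
  destruct (H2 m1 Hq1) as (t2 & m2 & Ht2 & Hr2 & Hq2).
  exists (t1 + t2), m2; repeat split; auto; [lia|econstructor; eauto].
Qed.

Lemma hoare_block w (P Q : (nat -> nat) -> Prop) l :
  Forall straight l -> (forall m, P m -> Q (effs w l m)) ->
  hoare w P (Block l) (length l) Q.
Proof.
  intros Hs H m Hm. exists (length l), (effs w l m).
  split; [lia|]. split; [constructor; auto|auto].
Qed.

(** [k] only bounds the iterations left, so the loop may stop early; the doubling loop of [modulus]
    needs this. *)
Lemma hoare_while w (I : nat -> (nat -> nat) -> Prop) r c T :
  (forall m, I 0 m -> m r = 0) ->
  (forall k, hoare w (fun m => I (S k) m /\ m r <> 0) c T (I k)) ->
  forall k, hoare w (I k) (While r c) (k * (T + 2) + 1)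
              (fun m => (exists k', I k' m) /\ m r = 0).
Proof.
  intros H0 Hs. induction k as [|k IH]; intros m Hm.
  - exists 1, m. split; [lia|]. split; [constructor; auto|eauto].
  - destruct (Nat.eq_dec (m r) 0) as [Hz|Hnz].
    + exists 1, m. split; [lia|]. split; [constructor; auto|eauto].
    + destruct (Hs k m (conj Hm Hnz)) as (t1 & m1 & Ht1 & Hr1 & Hq1).
      destruct (IH m1 Hq1) as (t2 & m2 & Ht2 & Hr2 & Hq2).
      exists (t1 + t2 + 2), m2. split; [lia|]. split; auto.
      econstructor; eauto.
Qed.

Lemma hoare_while_count w (I : nat -> (nat -> nat) -> Prop) r c T :
  (forall k m, I k m -> m r = k) ->
  (forall k, hoare w (I (S k)) c T (I k)) ->
  forall k, hoare w (I k) (While r c) (k * (T + 2) + 1) (I 0).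
Proof.
  intros Hr Hs k.
  refine (hoare_conseq _ _ _ _ _ _ _ _ (hoare_while w I r c T (Hr 0) _ k) _ _ _).
  - intros j.
    intros m [Hm _]; exact (Hs j m Hm).
  - auto.
  - intros m [[k' Hk] Hz]. apply Hr in Hk as E. congruence.
  - lia.
Qed.

Definition enc_edges (l : list (nat * nat)) : list nat :=
  flat_map (fun e => [fst e; snd e]) l.

Lemma enc_edges_app l1 l2 : enc_edges (l1 ++ l2) = enc_edges l1 ++ enc_edges l2.
Proof. apply flat_map_app. Qed.

Definition enc_hedges (l : list (nat * nat * nat)) : list nat :=
  flat_map (fun e => match e with (a, b, c) => [a; b; c] end) l.

Lemma length_enc_hedges l : length (enc_hedges l) = 3 * length l.
Proof. apply length_flat_map_const. intros [[a b] c] _; reflexivity. Qed.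

(** * Symbolic execution on unreduced values *)

Definition set (g : nat -> nat) (d v : nat) : nat -> nat :=
  fun i => if Nat.eqb i d then v else g i.

Lemma set_eq g d v : set g d v d = v.
Proof. unfold set; rewrite Nat.eqb_refl; reflexivity. Qed.

Lemma set_neq g d v i : i <> d -> set g d v i = g i.
Proof. unfold set; intros; destruct (Nat.eqb_spec i d); congruence. Qed.

(** The only store is [AEmit], which appends to the output and advances its pointer; this is what
    makes [rep] stable under every operation. *)
Inductive aop : Type :=
| ABin (o : binop) (d a b : nat)
| AConst (d k : nat)
| ALoad (d a : nat)
| AEmit (r : nat).

Definition acode (o : aop) : list instr :=
  match o with
  | ABin o d a b => [IBin o d a b]
  | AConst d k => [IConst d k]
  | ALoad d a => [ILoad d a]
  | AEmit r => [IStore 6 r; IBin OAdd 6 6 2]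
  end.

Definition ablock (l : list aop) : com := Block (flat_map acode l).

Definition reg (r : nat) : Prop := r < 24 /\ r <> 6.

Ltac regs := repeat (rewrite set_eq in * || (rewrite set_neq in * by lia)).

Section Abstract.

Variables (w : nat) (total : list nat) (m0 : nat -> nat).
Hypothesis Htotal : forall x, In x total -> x < 2 ^ w.
Hypothesis Hfit : 24 + length total < 2 ^ w.

(* The registers [0..23] except 6 hold [g]; cell 6 points to the end of the
   part of [total] that has been written from cell 24 on, and [rest] is still
   to be written; the memory beyond is as in [m0]. *)
Definition rep (g : nat -> nat) (rest : list nat) (m : nat -> nat) : Prop :=
  exists L, total = L ++ rest /\ m 6 = 24 + length L /\
    (forall i, i < length L -> m (24 + i) = nth i L 0) /\
    (forall i, reg i -> m i = g i) /\
    (forall i, 24 + length total <= i -> m i = m0 i).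

(** The bounds by [2 ^ w] rule out overflow, so that [set] describes what the machine does. The form
    [forall v, v = ...] lets a proof either name a computed value or substitute it. *)
Fixpoint wp (l : list aop) (Q : (nat -> nat) -> list nat -> Prop)
  (g : nat -> nat) (rest : list nat) : Prop :=
  match l with
  | [] => Q g rest
  | ABin o d a b :: l => (reg d /\ reg a /\ reg b) /\ binop_eval o (g a) (g b) < 2 ^ w /\
      forall v, v = binop_eval o (g a) (g b) -> wp l Q (set g d v) rest
  | AConst d k :: l => reg d /\ k < 2 ^ w /\ wp l Q (set g d k) rest
  | ALoad d a :: l => (reg d /\ reg a) /\ 24 + length total <= g a /\ m0 (g a) < 2 ^ w /\
      forall v, v = m0 (g a) -> wp l Q (set g d v) rest
  | AEmit r :: l => reg r /\ g 2 = 1 /\ exists rest', rest = g r :: rest' /\ wp l Q g rest'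
  end.

Lemma wp_app l1 l2 Q g rest : wp l1 (wp l2 Q) g rest -> wp (l1 ++ l2) Q g rest.
Proof.
  revert g rest; induction l1 as [|[o d a b|d k|d a|r] l IH]; intros g rest; simpl; auto.
  - intros (H1 & H2 & H3); auto.
  - intros (H1 & H2 & H3); auto.
  - intros (H1 & H2 & H3 & H4); auto 6.
  - intros (H1 & H2 & rest' & H3 & H4). eauto 6.
Qed.

Lemma rep_set g rest m d v v' :
  rep g rest m -> reg d -> v < 2 ^ w -> v' = v -> rep (set g d v) rest (upd w m d v').
Proof.
  intros (L & H1 & H2 & H3 & H4 & H5) [Hd Hd6] Hv ->. exists L. repeat split; auto.
  - rewrite upd_neq; auto.
  - intros i Hi. rewrite upd_neq by lia. auto.
  - intros i Hi. unfold upd, set. destruct (Nat.eqb_spec i d); auto.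
    apply Nat.mod_small; auto.
  - intros i Hi. rewrite upd_neq by lia. auto.
Qed.

Lemma rep_emit g rest m r :
  rep g (g r :: rest) m -> reg r -> g 2 = 1 ->
  rep g rest (effs w (acode (AEmit r)) m).
Proof.
  intros (L & H1 & H2 & H3 & H4 & H5) Hr Hg2. exists (L ++ [g r]).
  assert (Hl : length total = length L + S (length rest))
    by (rewrite H1, length_app; reflexivity).
  assert (Hgr : g r < 2 ^ w) by (apply Htotal; rewrite H1; apply in_elt).
  unfold effs; cbn [acode fold_left eff binop_eval].
  assert (H6 : upd w m (m 6) (m r) 6 = m 6) by (rewrite upd_neq by lia; auto).
  assert (H6' : upd w m (m 6) (m r) 2 = 1)
    by (rewrite upd_neq by lia; rewrite H4; auto; unfold reg; lia).
  rewrite H6, H6'. rewrite <- app_assoc; cbn [app]. rewrite length_app; cbn [length].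
  split; [exact H1|]. split; [|split; [|split]].
  - rewrite upd_eq, Nat.mod_small; lia.
  - intros i Hi. rewrite upd_neq by lia. unfold upd; destruct (Nat.eqb_spec (24 + i) (m 6)).
    + replace i with (length L) by lia. rewrite nth_middle, Nat.mod_small; rewrite H4; auto.
    + rewrite app_nth1 by lia. apply H3; lia.
  - intros i [Hi Hi6]. rewrite !upd_neq by lia. apply H4; split; auto.
  - intros i Hi. rewrite !upd_neq by lia. auto.
Qed.

Lemma wp_sound l Q : forall g rest m, wp l Q g rest -> rep g rest m ->
  exists g' rest', Q g' rest' /\ rep g' rest' (effs w (flat_map acode l) m).
Proof.
  induction l as [|o l IH]; intros g rest m Hw Hr; simpl in *; [eauto|].
  pose proof Hr as (L & _ & _ & _ & H4 & _).
  destruct o as [o d a b|d k|d a|r]; cbn [acode app].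
  - destruct Hw as ((Hd & Ha & Hb) & Hv & Hw).
    eapply IH; [apply Hw; reflexivity|]. apply rep_set; auto.
  - destruct Hw as (Hd & Hv & Hw).
    eapply IH; [apply Hw; reflexivity|]. apply rep_set; auto.
  - destruct Hw as ((Hd & Ha) & Hb & Hv & Hw).
    eapply IH; [apply Hw; reflexivity|]. apply rep_set; auto.
    rewrite (H4 a) by auto. destruct Hr as (L' & _ & _ & _ & _ & H5). auto.
  - destruct Hw as (Hrr & Hg2 & rest' & -> & Hw).
    eapply IH; [apply Hw; reflexivity|]. apply (rep_emit g rest' m r); auto.
Qed.

Definition abs (P : (nat -> nat) -> list nat -> Prop) (m : nat -> nat) : Prop :=
  exists g rest, P g rest /\ rep g rest m.

Definition triple (P : (nat -> nat) -> list nat -> Prop) (c : com) (T : nat)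
  (Q : (nat -> nat) -> list nat -> Prop) : Prop := hoare w (abs P) c T (abs Q).

Lemma triple_conseq (P P' Q Q' : (nat -> nat) -> list nat -> Prop) c T T' :
  triple P c T Q -> (forall g rest, P' g rest -> P g rest) ->
  (forall g rest, Q g rest -> Q' g rest) -> T <= T' -> triple P' c T' Q'.
Proof.
  intros H HP HQ HT. eapply hoare_conseq; eauto.
  - intros m (g & rest & Hp & Hr). exists g, rest; auto.
  - intros m (g & rest & Hp & Hr). exists g, rest; auto.
Qed.

(** The factor 2 pays for [AEmit], the one operation that takes two instructions. *)
Lemma triple_block (P Q : (nat -> nat) -> list nat -> Prop) l :
  (forall g rest, P g rest -> wp l Q g rest) ->
  triple P (ablock l) (2 * length l) Q.
Proof.
  intros H. assert (Hl : length (flat_map acode l) <= 2 * length l).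
  { clear. induction l as [|[] l IH]; simpl in *; lia. }
  eapply hoare_conseq; [apply hoare_block| | |exact Hl]; try (intros m Hm; exact Hm).
  - apply Forall_flat_map, Forall_forall. intros [] _; repeat constructor.
  - intros m (g & rest & Hp & Hr). destruct (wp_sound l Q g rest m) as (g' & rest' & Hq & Hr');
      auto. exists g', rest'; auto.
Qed.

Lemma triple_seq P Q R c1 c2 T1 T2 :
  triple P c1 T1 Q -> triple Q c2 T2 R -> triple P (c1 ;; c2) (T1 + T2) R.
Proof. apply hoare_seq. Qed.

Lemma triple_while_count (I : nat -> (nat -> nat) -> list nat -> Prop) r c T :
  reg r -> (forall k g rest, I k g rest -> g r = k) ->
  (forall k, triple (I (S k)) c T (I k)) ->
  forall k, triple (I k) (While r c) (k * (T + 2) + 1) (I 0).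
Proof.
  intros Hr Hk Hs k. apply (hoare_while_count w (fun k => abs (I k))); auto.
  intros j m (g & rest & Hi & L & _ & _ & _ & H4 & _). rewrite H4; eauto.
Qed.

Lemma triple_while (I : nat -> (nat -> nat) -> list nat -> Prop) r c T :
  reg r -> (forall g rest, I 0 g rest -> g r = 0) ->
  (forall k, triple (fun g rest => I (S k) g rest /\ g r <> 0) c T (I k)) ->
  forall k, triple (I k) (While r c) (k * (T + 2) + 1)
    (fun g rest => (exists k', I k' g rest) /\ g r = 0).
Proof.
  intros Hr Hk Hs k.
  assert (Hmr : forall g rest m, rep g rest m -> m r = g r)
    by (intros g rest m (L & _ & _ & _ & H4 & _); auto).
  refine (hoare_conseq _ _ _ _ _ _ _ _
    (hoare_while w (fun k => abs (I k)) r c T _ _ k) _ _ _).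
  - intros m (g & rest & Hi & Hrep). rewrite (Hmr _ _ _ Hrep); eauto.
  - intros j. refine (hoare_conseq _ _ _ _ _ _ _ _ (Hs j) _ (fun m H => H) (le_n _)).
      intros m [(g & rest & Hi & Hrep) Hnz]. exists g, rest. repeat split; auto.
      rewrite <- (Hmr _ _ _ Hrep); auto.
  - intros m Hm; exact Hm.
  - intros m [[k' (g & rest & Hi & Hrep)] Hz]. exists g, rest. repeat split; eauto.
    rewrite <- (Hmr _ _ _ Hrep); auto.
  - lia.
Qed.

(** Register 0 holds [n] and register 5 holds [n * n], whose addition moves a node to the next part.
    Register 10 is the node of [(x, y)] in the current part, 12 that of [(y, z)] in the next one,
    and 11 keeps [(y, z)] in part 0 for the closing edge. *)
Definition cross_ops (rx ry rz : nat) : list aop :=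
  [ABin OMul 10 rx 0; ABin OAdd 10 10 ry; ABin OMul 11 ry 0; ABin OAdd 11 11 rz;
   ABin OAdd 12 11 5; AEmit 10; AEmit 12;
   ABin OAdd 10 10 5; ABin OAdd 12 12 5; AEmit 10; AEmit 12;
   ABin OAdd 10 10 5; ABin OAdd 12 12 5; AEmit 10; AEmit 12;
   ABin OAdd 10 10 5; AEmit 11; AEmit 10].

Lemma wp_cross Q g rest n x y z rx ry rz :
  7 <= rx <= 9 -> 7 <= ry <= 9 -> 7 <= rz <= 9 ->
  g 0 = n -> g 2 = 1 -> g 5 = n * n -> g rx = x -> g ry = y -> g rz = z ->
  x < n /\ y < n /\ z < n -> 4 * (n * n) < 2 ^ w ->
  (forall g', (forall i, i < 10 \/ 12 < i -> g' i = g i) -> Q g' rest) ->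
  wp (cross_ops rx ry rz) Q g (enc_edges (cross n (x, y, z)) ++ rest).
Proof.
  intros Hrx Hry Hrz H0 H2 H5 Hx Hy Hz Hb Hn HQ.
  assert (Hxy : x * n + y < n * n) by nia. assert (Hyz : y * n + z < n * n) by nia.
  cbn [cross_ops wp binop_eval enc_edges cross flat_map app fst snd].
  repeat (regs; rewrite ?H0, ?H2, ?H5, ?Hx, ?Hy, ?Hz;
    match goal with
    | |- _ /\ _ => split
    | |- reg _ => unfold reg; lia
    | |- _ < _ => lia
    | |- 1 = 1 => reflexivity
    | |- exists _, _ => eexists; split; [f_equal; unfold node; lia|]
    | |- forall _, _ = _ -> _ => intros ? ?
    end).
  apply HQ. intros i Hi. rewrite !set_neq by lia. reflexivity.
Qed.

End Abstract.

Ltac wp_steps tac := cbn [wp binop_eval app];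
  repeat (regs; tac;
    match goal with
    | |- _ /\ _ => split
    | |- reg _ => unfold reg; lia
    | |- _ < _ => lia
    | |- _ <= _ => lia
    | |- _ = 1 => lia
    | |- forall _, _ = _ -> _ => intros ? ->
    end); regs; tac.

Definition perms_ops : list aop :=
  cross_ops 7 8 9 ++ cross_ops 7 9 8 ++ cross_ops 8 7 9 ++
  cross_ops 8 9 7 ++ cross_ops 9 7 8 ++ cross_ops 9 8 7.

(** Register 4 counts the hyperedges left and register 3 walks through their saved copy. *)
Definition hedges_loop : com :=
  While 4 (ablock ([ABin OSub 4 4 2; ALoad 7 3; ABin OAdd 3 3 2; ALoad 8 3;
                    ABin OAdd 3 3 2; ALoad 9 3; ABin OAdd 3 3 2] ++ perms_ops)).

(** Registers 13, 14 and 15 are the [q], [y] and [x] of [cliques]. Register 16 holds 0, so that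
    adding it copies a register. *)
Definition cliques_loop : com :=
  ablock [AConst 10 4; ABin OMul 13 10 0] ;;
  While 13 (ablock [ABin OSub 13 13 2; ABin OMul 12 13 0; ABin OAdd 14 0 16] ;;
    While 14 (ablock [ABin OSub 14 14 2; ABin OAdd 11 12 14; ABin OAdd 15 14 16] ;;
      While 15 (ablock [ABin OSub 15 15 2; ABin OAdd 10 12 15; AEmit 10; AEmit 11]))).

Section Loops.

Variables (w : nat) (total : list nat) (m0 : nat -> nat).
Hypothesis Htotal : forall x, In x total -> x < 2 ^ w.
Hypothesis Hfit : 24 + length total < 2 ^ w.
Variable n : nat.
Hypothesis Hn0 : 0 < n.
Hypothesis Hn : 4 * (n * n) < 2 ^ w.

(** The registers that stay fixed while edges are written; the number of nodes in register 21 is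
    kept for [modulus]. *)
Definition ctx (g : nat -> nat) : Prop :=
  (g 0 = n /\ g 2 = 1 /\ g 5 = n * n) /\ g 16 = 0 /\ g 21 = 4 * (n * n).

Lemma ctx_ext g g' :
  ctx g -> (forall i, In i [0; 2; 5; 16; 21] -> g' i = g i) -> ctx g'.
Proof. intros Hc He. unfold ctx. rewrite !He by (simpl; tauto). exact Hc. Qed.

Lemma wp_perms Q g rest a b c :
  ctx g -> g 7 = a -> g 8 = b -> g 9 = c -> a < n /\ b < n /\ c < n ->
  (forall g', (forall i, i < 10 \/ 12 < i -> g' i = g i) -> Q g' rest) ->
  wp w total m0 perms_ops Q g
    (enc_edges (flat_map (cross n) (perms (a, b, c))) ++ rest).
Proof.
  intros [(H0 & H2 & H5) _] H7 H8 H9 Hb HQ.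
  assert (step1 : forall Q g1 rest rx ry rz x y z,
    7 <= rx <= 9 -> 7 <= ry <= 9 -> 7 <= rz <= 9 ->
    (forall i, i < 10 \/ 12 < i -> g1 i = g i) ->
    g rx = x -> g ry = y -> g rz = z -> x < n /\ y < n /\ z < n ->
    (forall g', (forall i, i < 10 \/ 12 < i -> g' i = g i) -> Q g' rest) ->
    wp w total m0 (cross_ops rx ry rz) Q g1 (enc_edges (cross n (x, y, z)) ++ rest)).
  { intros Q' g1 rest' rx ry rz x y z ? ? ? He Hx Hy Hz Hxyz Hk.
    apply wp_cross; rewrite ?He by lia; auto.
    intros g' Hg'. apply Hk. intros i Hi. rewrite Hg', He; auto. }
  assert (step : forall Q g1 rest rx ry rz ops x y z,
    7 <= rx <= 9 -> 7 <= ry <= 9 -> 7 <= rz <= 9 ->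
    (forall i, i < 10 \/ 12 < i -> g1 i = g i) ->
    g rx = x -> g ry = y -> g rz = z -> x < n /\ y < n /\ z < n ->
    (forall g', (forall i, i < 10 \/ 12 < i -> g' i = g i) -> wp w total m0 ops Q g' rest) ->
    wp w total m0 (cross_ops rx ry rz ++ ops) Q g1 (enc_edges (cross n (x, y, z)) ++ rest)).
  { intros Q' g1 rest' rx ry rz ops x y z ? ? ? He Hx Hy Hz Hxyz Hk.
    apply wp_app, step1; auto. }
  unfold perms_ops, perms. cbn [flat_map].
  rewrite !enc_edges_app, app_nil_r, <- !app_assoc.
  apply step; try lia; auto. intros g1 Hg1.
  apply step; try lia; auto. intros g2 Hg2.
  apply step; try lia; auto. intros g3 Hg3.
  apply step; try lia; auto. intros g4 Hg4.
  apply step; try lia; auto. intros g5 Hg5.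
  apply step1; try lia; auto.
Qed.

(** [l] lists the hyperedges still to be read and [rest1] is what the later loops will write; the
    bound on [g 3 + 3 * k] keeps the read pointer from wrapping around. *)
Definition hedges_inv (rest1 : list nat) (k : nat) (g : nat -> nat) (rest : list nat) : Prop :=
  (ctx g /\ g 4 = k) /\ 24 + length total <= g 3 /\ g 3 + 3 * k < 2 ^ w /\
  exists l, length l = k /\
    rest = enc_edges (flat_map (fun e => flat_map (cross n) (perms e)) l) ++ rest1 /\
    (forall i, i < 3 * k -> m0 (g 3 + i) = nth i (enc_hedges l) 0) /\
    (forall a b c, In (a, b, c) l -> a < n /\ b < n /\ c < n).

Lemma hedges_loop_spec rest1 k :
  triple w total m0 (hedges_inv rest1 k) hedges_loop (k * 232 + 1) (hedges_inv rest1 0).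
Proof.
  (* 230 = 2 (7 + 6 * 18): seven operations fetch a hyperedge, and each of its six orderings takes
     eighteen. *)
  apply (triple_while_count w total m0 (hedges_inv rest1) 4 _ 230); clear k.
  - unfold reg; lia.
  - intros k g rest [[_ H4] _]; exact H4.
  - intros k. apply (triple_block w total m0 Htotal Hfit).
    intros g rest ([Hctx H4] & H3 & H3' & [|[[a b] c] l] & Hl & -> & Hm & Hb); [discriminate|].
    apply wp_app. pose proof Hctx as [(H0 & H2 & H5) _].
    destruct (Hb a b c) as (Ha & Hb' & Hc); [simpl; auto|].
    assert (m0 (g 3) = a) as Ea by (rewrite <- (Nat.add_0_r (g 3)), Hm; [reflexivity|lia]).
    assert (m0 (g 3 + 1) = b) as Eb by (rewrite Hm; [reflexivity|lia]).
    assert (m0 (g 3 + 1 + 1) = c) as Ec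
      by (rewrite <- Nat.add_assoc, Hm; [reflexivity|simpl; lia]).
    assert (Hnn : n <= n * n) by nia.
    wp_steps ltac:(rewrite ?H2, ?Ea, ?Eb, ?Ec).
    cbn [flat_map]. rewrite enc_edges_app, <- app_assoc.
    apply wp_perms.
    + apply (ctx_ext g); auto. intros i Hi.
      simpl in Hi; repeat (destruct Hi as [<-|Hi]; [regs; reflexivity|]); destruct Hi.
    + regs; auto.
    + regs; auto.
    + regs; auto.
    + auto.
    + intros g' Hg'. unfold hedges_inv. rewrite !Hg' by lia.
      split; [split|].
      * apply (ctx_ext g); auto. intros i Hi.
        simpl in Hi; repeat (destruct Hi as [<-|Hi];
          [rewrite Hg' by lia; regs; reflexivity|]); destruct Hi.
      * regs; lia.
      * regs. split; [lia|]. split; [lia|]. exists l. injection Hl as Hl.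
        split; [auto|]. split; [auto|]. split.
        -- intros i Hi.
           replace (g 3 + 1 + 1 + 1 + i) with (g 3 + (3 + i)) by lia.
           rewrite Hm by lia. reflexivity.
        -- intros a' b' c' Hin. apply Hb; right; exact Hin.
Qed.

Ltac ctx_frame := apply (ctx_ext _ _ ltac:(eassumption));
  let i := fresh in let Hi := fresh in intros i Hi;
  simpl in Hi; repeat (destruct Hi as [<-|Hi]; [regs; reflexivity|]); destruct Hi.

Definition cliques_inv3 (q y : nat) (rest3 : list nat) (k : nat) (g : nat -> nat) (rest : list nat) : Prop :=
  ctx g /\ g 15 = k /\ (g 13 = q /\ g 12 = q * n /\ g 14 = y /\ g 11 = q * n + y) /\
  q < 4 * n /\ y < n /\ k <= y /\
  rest = enc_edges (map (fun x => (q * n + x, q * n + y)) (down k)) ++ rest3.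

Definition cliques_inv2 (q : nat) (rest2 : list nat) (k : nat) (g : nat -> nat) (rest : list nat) : Prop :=
  ctx g /\ g 14 = k /\ (g 13 = q /\ g 12 = q * n) /\ q < 4 * n /\ k <= n /\
  rest = enc_edges (flat_map (fun y => map (fun x => (q * n + x, q * n + y)) (down y))
           (down k)) ++ rest2.

Definition cliques_inv1 (k : nat) (g : nat -> nat) (rest : list nat) : Prop :=
  ctx g /\ g 13 = k /\ k <= 4 * n /\
  rest = enc_edges (flat_map (fun q =>
    flat_map (fun y => map (fun x => (q * n + x, q * n + y)) (down y)) (down n)) (down k)).

Lemma cliques_loop_spec :
  triple w total m0 (fun g rest => ctx g /\ rest = enc_edges (cliques n)) cliques_loop
    (200 * (n * n * n)) (fun g rest => ctx g /\ rest = []).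
Proof.
  assert (H3 : forall q y rest3 k, triple w total m0 (cliques_inv3 q y rest3 k)
    (While 15 (ablock [ABin OSub 15 15 2; ABin OAdd 10 12 15; AEmit 10; AEmit 11]))
    (k * (8 + 2) + 1) (cliques_inv3 q y rest3 0)).
  { intros q y rest3 k. apply triple_while_count; auto; clear k.
    - unfold reg; lia.
    - intros k g rest H; apply H.
    - intros k. apply (triple_block w total m0 Htotal Hfit _ _ [_; _; _; _]).
      intros g rest (Hctx & H15 & (H13 & H12 & H14 & H11) & Hq & Hy & Hk & ->).
      pose proof Hctx as [(H0 & H2 & H5) _].
      assert (q * n + n <= 4 * (n * n)) by nia.
      cbn [down map]. unfold enc_edges at 1. cbn [flat_map fst snd app].
      wp_steps ltac:(rewrite ?H2, ?H12, ?H15).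
      eexists; split; [f_equal; lia|]. wp_steps ltac:(rewrite ?H2).
      eexists; split; [f_equal; lia|].
      split; [ctx_frame|]. regs. repeat split; auto; lia. }
  assert (H2 : forall q rest2 k, triple w total m0 (cliques_inv2 q rest2 k)
    (While 14 (ablock [ABin OSub 14 14 2; ABin OAdd 11 12 14; ABin OAdd 15 14 16] ;;
      While 15 (ablock [ABin OSub 15 15 2; ABin OAdd 10 12 15; AEmit 10; AEmit 11])))
    (k * ((2 * 3 + (n * (8 + 2) + 1)) + 2) + 1) (cliques_inv2 q rest2 0)).
  { intros q rest2 k. apply triple_while_count; auto; clear k.
    - unfold reg; lia.
    - intros k g rest H; apply H.
    - intros k. apply triple_seq with
        (Q := fun g rest => cliques_inv3 q k (enc_edges (flat_map (fun y =>
           map (fun x => (q * n + x, q * n + y)) (down y)) (down k)) ++ rest2) k g rest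
           /\ k < n).
      + apply (triple_block w total m0 Htotal Hfit _ _ [_; _; _]).
        intros g rest (Hctx & H14 & (H13 & H12) & Hq & Hk & ->).
        pose proof Hctx as [(H0 & H2 & H5) (H16 & _)].
        assert (q * n + n <= 4 * (n * n)) by nia.
        wp_steps ltac:(rewrite ?H2, ?H12, ?H14, ?H16).
        split; [ctx_frame|]. regs. repeat split; auto; try lia.
        cbn [down flat_map]. rewrite enc_edges_app, app_assoc. reflexivity.
      + intros m (g & rest & [Hi Hk] & Hr).
        refine (triple_conseq _ _ _ _ _ _ _ _ _ _ (H3 q k _ k) (fun g rest H => H) _ _ m _).
        * intros g' rest' (Hctx & H15 & (H13 & H12 & H14 & H11) & Hq & _ & _ & ->).
          repeat split; auto; try apply Hctx; lia.
        * nia.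
        * exists g, rest; auto. }
  (* This adds up to [40 n^3 + 36 n^2 + 36 n + 5], which is at most [200 n^3] as [n] is positive. *)
  eapply triple_conseq with (T := 2 * 2 + ((4 * n) *
     ((2 * 3 + (n * ((2 * 3 + (n * (8 + 2) + 1)) + 2) + 1)) + 2) + 1)).
  - apply triple_seq with (Q := cliques_inv1 (4 * n)).
    + apply (triple_block w total m0 Htotal Hfit _ _ [_; _]).
      intros g rest H. exact H.
    + apply triple_while_count with (I := cliques_inv1).
      * unfold reg; lia.
      * intros k g rest H; apply H.
      * intros k. apply triple_seq with (Q := fun g rest =>
          cliques_inv2 k (enc_edges (flat_map (fun q =>
            flat_map (fun y => map (fun x => (q * n + x, q * n + y)) (down y)) (down n))
            (down k))) n g rest).
        -- apply (triple_block w total m0 Htotal Hfit _ _ [_; _; _]).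
           intros g rest (Hctx & H13 & Hk & ->).
           pose proof Hctx as [(H0 & H2' & H5) (H16 & _)].
           assert (k * n + n <= 4 * (n * n) /\ 4 * n <= 4 * (n * n)) as [? ?] by nia.
           wp_steps ltac:(rewrite ?H2', ?H13, ?H0, ?H16, ?Nat.sub_succ, ?Nat.sub_0_r).
           split; [ctx_frame|]. regs. repeat split; auto; try lia.
           cbn [down flat_map]. rewrite enc_edges_app. reflexivity.
        -- eapply triple_conseq; [eapply (H2 k)|intros g rest H; exact H| |lia].
           intros g rest (Hctx & H14 & (H13 & H12) & Hq & _ & ->).
           repeat split; auto; try apply Hctx; lia.
  - intros g rest [Hctx ->]. pose proof Hctx as [(H0 & _) _].
    assert (4 * n <= 4 * (n * n)) by nia.
    wp_steps ltac:(rewrite ?H0).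
    split; [ctx_frame|]. regs. repeat split; auto; lia.
  - intros g rest (Hctx & _ & _ & ->). auto.
  - nia.
Qed.

End Loops.

Lemma length_enc_edges l : length (enc_edges l) = 2 * length l.
Proof. apply length_flat_map_const; reflexivity. Qed.

(** The encoding opens with the number of edges, so it is computed from the formula of [gm_graph_of]
    before any edge is written. *)
Definition header : com :=
  ablock [ABin OMul 5 0 0; AConst 16 0; AConst 10 4; ABin OMul 21 10 5; AEmit 21;
          AConst 10 24; ABin OMul 10 10 4; ABin OSub 11 0 2; ABin OMul 11 11 5;
          ABin OAdd 11 11 11; ABin OAdd 10 10 11; AEmit 10].

(** Register 9 doubles until it exceeds the number of nodes, truncated subtraction serving as the
    comparison. It ends as 2 to the power [S (log2 sz)], whose [c]-th power is the simulated
    modulus. *)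
Definition modulus (c : nat) : com :=
  ablock [ABin OAdd 8 21 2; AConst 9 2; ABin OSub 10 8 9] ;;
  While 10 (ablock [ABin OAdd 9 9 9; ABin OSub 10 8 9]) ;;
  ablock (AConst 17 1 :: repeat (ABin OMul 17 17 9) c ++ [AConst 18 24]).

Definition generator (c : nat) : com :=
  header ;; hedges_loop ;; cliques_loop ;; modulus c.

Section Generator.

Variables (w : nat) (m0 : nat -> nat) (H : hypergraph) (F : nat).
Let n := fst H.
Let h := length (snd H).
Let G := graph_of H.
Let total := enc_graph G.
Hypothesis HV : valid_hypergraph H.
Hypothesis Hn0 : 0 < n.
Hypothesis Hn : 4 * (n * n) < 2 ^ w.
Hypothesis HF : 24 + length total <= F.
Hypothesis HF' : F + 3 * h < 2 ^ w.
Hypothesis Hm0 : forall i, i < 3 * h -> m0 (F + i) = nth i (enc_hedges (snd H)) 0.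

Lemma length_total : length total = 2 + 2 * gm G.
Proof. unfold total, enc_graph, gm. simpl length. rewrite length_enc_edges. reflexivity. Qed.

Lemma total_lt x : In x total -> x < 2 ^ w.
Proof.
  pose proof length_total as Hl.
  intros [<-|[<-|Hx]].
  - exact Hn.
  - fold (gm G). lia.
  - apply in_flat_map in Hx as ([u v] & Huv & Hx).
    apply (valid_graph_of H HV) in Huv. simpl in Huv. unfold n in Hn.
    destruct Hx as [<-|[<-|[]]]; simpl; lia.
Qed.

Lemma fit : 24 + length total < 2 ^ w.
Proof. lia. Qed.

Lemma header_spec :
  triple w total m0
    (fun g rest => (g 0 = n /\ g 2 = 1) /\ g 4 = h /\ g 3 = F /\ rest = total)
    header 24 (hedges_inv w total m0 n (enc_edges (cliques n)) h).
Proof.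
  apply (triple_block w total m0 total_lt fit _ _ [_; _; _; _; _; _; _; _; _; _; _; _]).
  intros g rest ((H0 & H2) & H4 & H3 & ->).
  pose proof (gm_graph_of H) as Hgm. fold h n G in Hgm. pose proof length_total as Hl.
  assert (E : 2 * n * n * (n - 1) = (n - 1) * (n * n) + (n - 1) * (n * n)) by nia.
  unfold total at 1, enc_graph. fold (gm G).
  assert (n <= n * n) by nia.
  wp_steps ltac:(rewrite ?H0, ?H2, ?H4).
  eexists; split; [reflexivity|].
  wp_steps ltac:(rewrite ?H0, ?H2, ?H4).
  eexists; split; [f_equal; fold (gm G); lia|].
  split; [split; [|regs; exact H4]|].
  - unfold ctx. regs. repeat split; auto; lia.
  - regs. rewrite H3. split; [exact HF|]. split; [exact HF'|].
    exists (snd H). split; [reflexivity|]. split; [|split].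
    + unfold G, graph_of; simpl. rewrite enc_edges_app. reflexivity.
    + exact Hm0.
    + intros a b c Hin. apply HV in Hin. unfold n; lia.
Qed.

Lemma wp_repeat_mul Q l d s k : d <> s -> reg d -> reg s -> forall g rest,
  0 < g s -> g d * g s ^ k < 2 ^ w ->
  (forall g', g' d = g d * g s ^ k -> (forall i, i <> d -> g' i = g i) ->
     wp w total m0 l Q g' rest) ->
  wp w total m0 (repeat (ABin OMul d d s) k ++ l) Q g rest.
Proof.
  intros Hds Hd Hs. induction k as [|k IH]; intros g rest Hpos Hlt HQ; simpl.
  - apply HQ; simpl; auto; lia.
  - rewrite Nat.pow_succ_r' in *.
    assert (0 < g s ^ k) by (apply Nat.neq_0_lt_0, Nat.pow_nonzero; lia).
    split; [auto|]. split; [nia|].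
    intros v ->. apply IH; rewrite ?set_eq, ?set_neq by auto; auto; [lia|].
    intros g' Hg' He. apply HQ; [lia|].
    intros i Hi. rewrite He, set_neq; auto.
Qed.

Lemma modulus_spec c sz :
  2 * sz + 2 < 2 ^ w -> word_size c sz < w ->
  triple w total m0 (fun g rest => (g 2 = 1 /\ g 21 = sz) /\ rest = []) (modulus c)
    (6 + (sz * (2 * 2 + 2) + 1 + (2 * (2 + c))))
    (fun g rest => (g 2 = 1 /\ g 17 = 2 ^ word_size c sz /\ g 18 = 24) /\ rest = []).
Proof.
  intros Hsz Hw.
  (* Doubling raises register 9, so [sz + 1 - g 9] bounds the iterations left; charging [sz] of them
     is crude but affordable. The case [i = 0] is the start, where [2 ^ i <= sz] fails for
     [sz = 0]. *)
  set (I := fun k (g : nat -> nat) (rest : list nat) => rest = [] /\ (g 2 = 1 /\ g 8 = sz + 1) /\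
    g 10 = sz + 1 - g 9 /\ sz + 1 - g 9 <= k /\
    exists i, g 9 = 2 ^ S i /\ (i = 0 \/ 2 ^ i <= sz)).
  apply triple_seq with (Q := I sz); [|apply triple_seq with
     (Q := fun g rest => (g 2 = 1 /\ g 9 = 2 ^ S (Nat.log2 sz)) /\ rest = [])].
  - apply (triple_block w total m0 total_lt fit _ _ [_; _; _]).
    intros g rest ((H2 & H3) & ->).
    wp_steps ltac:(rewrite ?H2, ?H3).
    unfold I; regs. repeat split; auto; [lia|]. exists 0; auto.
  - eapply triple_conseq; [apply (triple_while w total m0 fit I 10
        (ablock [ABin OAdd 9 9 9; ABin OSub 10 8 9]) (2 * 2)) with (k := sz)| | |lia].
    + unfold reg; lia.
    + intros g rest (_ & _ & H10 & Hk & _). lia.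
    + intros k. apply (triple_block w total m0 total_lt fit _ _ [_; _]).
      intros g rest ((-> & (H2 & H8) & H10 & Hk & i & H9 & Hi) & Hnz).
      pose proof (Nat.pow_succ_r' 2 i). pose proof (Nat.pow_succ_r' 2 (S i)).
      pose proof (pow2_pos i).
      wp_steps ltac:(rewrite ?H8).
      unfold I; regs. repeat split; auto; try lia.
      exists (S i). split; [lia|right; lia].
    + intros g rest HI; exact HI.
    + intros g rest ((k' & -> & (H2 & H8) & H10 & _ & i & H9 & Hi) & Hz).
      split; [split; [exact H2|]|auto]. rewrite H9. f_equal. f_equal. destruct (Nat.eq_dec sz 0) as [->|Hs].
      * destruct Hi as [->|Hi]; [reflexivity|]. pose proof (pow2_pos i); lia.
      * symmetry; apply Nat.log2_unique; [lia|]. split; [|lia].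
        destruct Hi as [->|Hi]; simpl; lia.
  - assert (E : length (AConst 17 1 :: repeat (ABin OMul 17 17 9) c ++ [AConst 18 24]) = 2 + c)
      by (simpl; rewrite length_app, repeat_length; simpl; lia).
    rewrite <- E. apply (triple_block w total m0 total_lt fit).
    intros g rest ((H2 & H9) & ->).
    assert (Hp : (2 ^ S (Nat.log2 sz)) ^ c = 2 ^ word_size c sz)
      by (rewrite <- Nat.pow_mul_r, Nat.mul_comm; reflexivity).
    assert (2 ^ word_size c sz < 2 ^ w) by (apply Nat.pow_lt_mono_r; lia).
    cbn [wp]. split; [unfold reg; lia|]. split; [lia|].
    apply wp_repeat_mul; try (unfold reg; lia); regs; rewrite ?H9.
    + apply pow2_pos.
    + lia.
    + intros g' Hg' He. specialize (He 2). regs. rewrite Hp in Hg'.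
      wp_steps idtac; auto; lia.
Qed.

Lemma generator_spec c :
  let sz := gn G in 2 * sz + 2 < 2 ^ w -> word_size c sz < w ->
  triple w total m0
    (fun g rest => (g 0 = n /\ g 2 = 1) /\ g 4 = h /\ g 3 = F /\ rest = total)
    (generator c) (24 + (h * 232 + 1 + (200 * (n * n * n) +
        (6 + (sz * (2 * 2 + 2) + 1 + (2 * (2 + c)))))))
    (fun g rest => (g 2 = 1 /\ g 17 = 2 ^ word_size c sz /\ g 18 = 24) /\ rest = []).
Proof.
  intros sz Hsz Hw.
  apply triple_seq with (1 := header_spec).
  eapply triple_seq; [apply hedges_loop_spec; auto using total_lt, fit|].
  apply triple_seq with (Q := fun g rest => ctx n g /\ rest = []).
  - eapply triple_conseq; [apply (cliques_loop_spec w total m0 total_lt fit n Hn0 Hn)| | |lia].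
    + intros g rest ([Hc _] & _ & _ & l & Hl & -> & _).
      split; auto. destruct l; [reflexivity|discriminate].
    + auto.
  - eapply triple_conseq; [apply (modulus_spec c sz); auto; lia| | |lia].
    + intros g rest [[(_ & H2 & _) (_ & H21)] ->]. repeat split; auto.
    + auto.
Qed.

End Generator.

(** * Relocating the input *)

(* All cells are occupied by the input at the start.  Overwriting [h] by
   [h * n ^ k] yields the address of a free region without losing [n] and [h];
   the cells needed as registers are saved there first, then the rest of the
   input is copied. *)
Definition prologue (k : nat) : com :=
  Block (repeat (IBin OMul 1 1 0) k) ;;
  Block (IStore 1 2 :: IConst 2 1 ::
         flat_map (fun j => [IBin OAdd 1 1 2; IStore 1 j]) (seq 3 21)) ;;
  Block (IConst 4 1 :: repeat (IBin OMul 4 4 0) k) ;;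
  Block [IConst 5 21; IBin OSub 7 1 5; IBin ODiv 4 7 4; IConst 8 3; IBin OMul 9 4 8;
         IConst 8 22; IBin OSub 9 9 8; IConst 3 24] ;;
  While 9 (Block [IBin OSub 9 9 2; IBin OAdd 1 1 2; ILoad 8 3; IStore 1 8;
                  IBin OAdd 3 3 2]) ;;
  Block [IConst 16 0; IBin OAdd 3 7 16; IConst 6 24].

Ltac upds := repeat (rewrite upd_eq || rewrite upd_neq by lia).

Lemma effs_app w l1 l2 m : effs w (l1 ++ l2) m = effs w l2 (effs w l1 m).
Proof. apply fold_left_app. Qed.

Lemma effs_repeat_mul w d s k m :
  d <> s -> 0 < m s -> m d * m s ^ k < 2 ^ w ->
  effs w (repeat (IBin OMul d d s) k) m d = m d * m s ^ k /\
  forall i, i <> d -> effs w (repeat (IBin OMul d d s) k) m i = m i.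
Proof.
  intros Hds. revert m; induction k as [|k IH]; intros m Hpos Hlt.
  - split; auto. simpl; lia.
  - rewrite Nat.pow_succ_r' in *.
    assert (0 < m s ^ k) by (apply Nat.neq_0_lt_0, Nat.pow_nonzero; lia).
    assert (Hv : m d * m s < 2 ^ w) by nia.
    destruct (IH (upd w m d (m d * m s))) as [IH1 IH2].
    + rewrite upd_neq; auto.
    + rewrite upd_eq, upd_neq, Nat.mod_small; auto. lia.
    + change (repeat (IBin OMul d d s) (S k)) with ([IBin OMul d d s] ++ repeat (IBin OMul d d s) k).
      rewrite effs_app. unfold effs at 2 4. cbn [fold_left eff binop_eval]. split.
      * rewrite IH1, upd_eq, upd_neq, Nat.mod_small; auto; lia.
      * intros i Hi. rewrite IH2, upd_neq; auto.
Qed.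

Lemma straight_repeat o d a b k : Forall straight (repeat (IBin o d a b) k).
Proof. apply Forall_forall. intros i Hi. apply repeat_spec in Hi as ->. exact I. Qed.

Section Prologue.

Variables (w : nat) (inp : list nat) (n h k : nat).
Let F := h * n ^ k.
Hypothesis Hn : 0 < n.
Hypothesis Hh : 0 < h.
Hypothesis HF : 3 * h + 24 <= F.
Hypothesis HF' : F + 3 * h + 24 < 2 ^ w.
Hypothesis H0 : nth 0 inp 0 = n.
Hypothesis H1 : nth 1 inp 0 = h.
Hypothesis Hinp : forall i, nth i inp 0 < 2 ^ w.

(** Cells from [lo] to [F] still hold the initial memory, and thus 0 past the end of the input; the
    simulated memory relies on this. *)
Definition saved (s lo : nat) (m : nat -> nat) : Prop :=
  (m 0 = n /\ m 2 = 1) /\ (forall i, i < s -> m (F + i) = nth (i + 2) inp 0) /\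
  (forall i, lo <= i < F -> m i = nth i inp 0).

Lemma saved_ext s lo m m' :
  saved s lo m -> (forall i, i = 0 \/ i = 2 \/ lo <= i -> m' i = m i) -> lo <= F ->
  saved s lo m'.
Proof.
  intros ([Ha Hb] & Hc & Hd) He Hlo.
  split; [rewrite !He by auto; auto|]. split.
  - intros i Hi. rewrite He by lia. auto.
  - intros i Hi. rewrite He by lia. auto.
Qed.

Lemma save_block cnt : forall s m,
  saved (S s) (3 + s) m -> m 1 = F + s -> s + cnt <= 21 ->
  let m' := effs w (flat_map (fun j => [IBin OAdd 1 1 2; IStore 1 j]) (seq (3 + s) cnt)) m in
  saved (S (s + cnt)) (3 + (s + cnt)) m' /\ m' 1 = F + (s + cnt).
Proof.
  induction cnt as [|cnt IH]; intros s m HS Hm1 Hs; cbn [seq flat_map].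
  - rewrite Nat.add_0_r. auto.
  - rewrite effs_app. replace (s + S cnt) with (S s + cnt) by lia.
    change (S (3 + s)) with (3 + S s).
    destruct HS as ([Ha Hb] & Hc & Hd).
    apply IH; try lia; unfold effs; cbn [fold_left eff binop_eval]; rewrite Hm1, Hb.
    + assert (E : upd w m 1 (F + s + 1) 1 = F + s + 1) by (upds; apply Nat.mod_small; lia).
      rewrite E. split; [upds; auto|]. split.
      * intros i Hi. destruct (Nat.eq_dec i (S s)) as [->|Hne].
        -- replace (F + S s) with (F + s + 1) by lia. upds.
           rewrite Hd by lia. replace (S s + 2) with (3 + s) by lia. apply Nat.mod_small; auto.
        -- upds. apply Hc; lia.
      * intros i Hi. upds. apply Hd; lia.
    + assert (E : upd w m 1 (F + s + 1) 1 = F + s + 1) by (upds; apply Nat.mod_small; lia).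
      rewrite E. upds. rewrite Nat.mod_small; lia.
Qed.

(** The second block saves the 22 words of cells 2 to 23, one at [F] and 21 behind it, in 2 + 2 * 21
    = 44 steps. The loop copies the other [3 * h - 22], none if this truncates to 0. *)
Lemma prologue_spec :
  hoare w (fun m => forall i, m i = nth i inp 0) (prologue k)
    (k + (44 + (S k + (8 + (((3 * h - 22) * (5 + 2) + 1) + 3)))))
    (fun m => saved (3 * h) 24 m /\ m 4 = h /\ m 3 = F /\ m 6 = 24).
Proof.
  assert (Hnk : 0 < n ^ k) by (apply Nat.neq_0_lt_0, Nat.pow_nonzero; lia).
  assert (HnF : n ^ k <= F) by (unfold F; nia).
  apply hoare_seq with (Q := fun m => m 1 = F /\ forall i, i <> 1 -> m i = nth i inp 0);
    [|apply hoare_seq with (Q := fun m => saved 22 24 m /\ m 1 = F + 21);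
    [|apply hoare_seq with (Q := fun m => saved 22 24 m /\ m 1 = F + 21 /\ m 4 = n ^ k);
    [|apply hoare_seq with (Q := fun m => saved 22 24 m /\ m 1 = F + 21 /\ m 4 = h /\
         m 7 = F /\ m 9 = 3 * h - 22 /\ m 3 = 24);
    [|apply hoare_seq with (Q := fun m => saved (3 * h) 24 m /\ m 4 = h /\ m 7 = F)]]]].
  - rewrite <- (repeat_length (IBin OMul 1 1 0) k) at 2.
    apply hoare_block; [apply straight_repeat|]. intros m Hm.
    destruct (effs_repeat_mul w 1 0 k m) as [E1 E2]; rewrite ?Hm, ?H0, ?H1; auto.
    + fold F; lia.
    + split; [rewrite E1, !Hm, H0, H1; reflexivity|]. intros i Hi. rewrite E2; auto.
  - apply (hoare_block w _ _ ([IStore 1 2; IConst 2 1] ++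
         flat_map (fun j => [IBin OAdd 1 1 2; IStore 1 j]) (seq 3 21))); [repeat constructor|].
    intros m [Hm1 Hm].
    rewrite (effs_app w [IStore 1 2; IConst 2 1]).
    apply (save_block 21 0); try lia; unfold effs; cbn [fold_left eff]; rewrite Hm1.
    + split; [|split].
      * upds. rewrite Hm, H0 by lia. split; [auto|apply Nat.mod_small; lia].
      * intros i Hi. replace i with 0 by lia. rewrite Nat.add_0_r. upds.
        rewrite Hm by lia. apply Nat.mod_small; auto.
      * intros i Hi. upds. apply Hm; lia.
    + upds. lia.
  - replace (S k) with (length (IConst 4 1 :: repeat (IBin OMul 4 4 0) k))
      by (simpl; rewrite repeat_length; reflexivity).
    apply hoare_block; [constructor; [exact I|apply straight_repeat]|].
    intros m [HS Hm1]. pose proof HS as ([Ha Hb] & _).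
    destruct (effs_repeat_mul w 4 0 k (upd w m 4 1)) as [E1 E2]; upds; rewrite ?Ha; auto.
    + rewrite Nat.mod_small; lia.
    + change (effs w (IConst 4 1 :: repeat (IBin OMul 4 4 0) k) m)
        with (effs w (repeat (IBin OMul 4 4 0) k) (upd w m 4 1)).
      split; [|split].
      * apply (saved_ext _ _ m); auto; [|lia]. intros i Hi. rewrite E2 by lia. upds; auto.
      * rewrite E2 by lia. upds; auto.
      * rewrite E1. upds. rewrite Ha, Nat.mod_small; lia.
  - apply (hoare_block w _ _ [_; _; _; _; _; _; _; _]); [repeat constructor|].
    intros m (HS & Hm1 & Hm4). unfold effs; cbn [fold_left eff binop_eval].
    assert (E7 : (F + 21 - 21) mod 2 ^ w = F) by (rewrite Nat.mod_small; lia).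
    (* Dividing by [n ^ k] recovers the number of hyperedges that was overwritten in cell 1. *)
    assert (Ed : F / n ^ k = h) by (apply Nat.div_mul; lia).
    split; [|split; [|split; [|split; [|split]]]].
    + apply (saved_ext _ _ m); auto; [|lia]. intros i Hi. upds; auto.
    + upds; auto.
    + upds. rewrite Hm1, Hm4, (Nat.mod_small 21), E7, Ed by lia. apply Nat.mod_small; lia.
    + upds. rewrite Hm1, (Nat.mod_small 21), E7 by lia. reflexivity.
    + upds. rewrite Hm1, Hm4, (Nat.mod_small 21), E7, Ed by lia.
      rewrite (Nat.mod_small h), (Nat.mod_small 3), (Nat.mod_small 22), (Nat.mod_small (h * 3)) by lia.
      rewrite Nat.mod_small; lia.
    + upds. apply Nat.mod_small; lia.
  - set (J := fun r m => (m 4 = h /\ m 7 = F) /\ m 9 = r /\ exists s, saved (22 + s) 24 m /\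
      m 3 = 24 + s /\ m 1 = F + 21 + s /\ s + r = 3 * h - 22).
    refine (hoare_conseq w _ _ _ _ _ _ _
      (hoare_while_count w J 9 _ 5 _ _ (3 * h - 22)) _ _ (le_n _)).
    + intros r m Hm; apply Hm.
    + intros r. apply (hoare_block w _ _ [_; _; _; _; _]); [repeat constructor|].
      intros m ([Hm4 Hm7] & Hm9 & s & ([Ha Hb] & Hc & Hd) & Hm3 & Hm1 & Hs).
      assert (E1 : (m 1 + m 2) mod 2 ^ w = F + 22 + s)
        by (rewrite Hm1, Hb, Nat.mod_small; lia).
      unfold effs; cbn [fold_left eff binop_eval].
      rewrite (upd_neq w m 9 (m 9 - m 2) 1), (upd_neq w m 9 (m 9 - m 2) 2) by lia.
      set (mb := upd w (upd w m 9 (m 9 - m 2)) 1 (m 1 + m 2)).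
      assert (B : forall i, i <> 1 -> i <> 9 -> mb i = m i) by (intros; unfold mb; upds; auto).
      assert (B1 : mb 1 = F + 22 + s) by (unfold mb; rewrite upd_eq; exact E1).
      assert (B9 : mb 9 = r) by (unfold mb; upds; rewrite Hm9, Hb, Nat.mod_small; lia).
      rewrite (B 3), Hm3, (B (24 + s)), Hd by lia.
      set (mc := upd w mb 8 (nth (24 + s) inp 0)).
      assert (C : forall i, i <> 8 -> mc i = mb i) by (intros; unfold mc; upds; auto).
      assert (C8 : mc 8 = nth (24 + s) inp 0)
        by (unfold mc; rewrite upd_eq; apply Nat.mod_small; auto).
      rewrite (C 1), B1, C8 by lia. upds. rewrite !C, !B by lia.
      split; [split|split].
      * upds. rewrite C, B by lia; auto.
      * upds. rewrite C, B by lia; auto.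
      * upds. rewrite C by lia; auto.
      * exists (S s). split; [split; [|split]|].
        -- upds. rewrite !C, !B by lia. auto.
        -- intros i Hi. destruct (Nat.eq_dec i (22 + s)) as [->|Hne].
           ++ replace (F + (22 + s)) with (F + 22 + s) by lia. upds.
              rewrite Nat.mod_small by auto. f_equal; lia.
           ++ upds. rewrite C, B by lia. apply Hc; lia.
        -- intros i Hi. upds. rewrite C, B by lia. apply Hd; lia.
        -- upds. rewrite C, B1, Hm3, Hb by lia. split; [|split; [lia|lia]].
           rewrite Nat.mod_small; lia.
    + intros m (HS & Hm1 & Hm4 & Hm7 & Hm9 & Hm3). repeat split; auto; try apply HS.
      exists 0. rewrite Hm1, Hm3. repeat split; auto; try apply HS; lia.
    + intros m ([Hm4 Hm7] & _ & s & ([Ha Hb] & Hc & Hd) & _ & _ & Hs).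
      repeat split; auto. intros i Hi. apply Hc; lia.
  - apply (hoare_block w _ _ [_; _; _]); [repeat constructor|].
    intros m (HS & Hm4 & Hm7). unfold effs; cbn [fold_left eff binop_eval].
    split; [|split; [|split]].
    + apply (saved_ext _ _ m); auto; [|lia]. intros i Hi. upds; auto.
    + upds; auto.
    + upds. rewrite Hm7, (Nat.mod_small 0), Nat.mod_small; lia.
    + upds. apply Nat.mod_small; lia.
Qed.

End Prologue.

(* The simulated machine reads its input modulo its own word size, which depends
   on the number of nodes only, and the number of edges may overflow it. *)
Definition normalize : com :=
  Block [IBin OSub 10 6 18] ;;
  While 10 (Block [IBin OSub 10 10 2; IBin OSub 6 6 2; ILoad 8 6; IBin OMod 8 8 17;
                   IStore 6 8]).

Lemma normalize_spec w total m0 wg :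
  24 + length total < 2 ^ w -> wg < w ->
  hoare w
    (abs total m0 (fun g rest => (g 2 = 1 /\ g 17 = 2 ^ wg /\ g 18 = 24) /\ rest = []))
    normalize (1 + (length total * (5 + 2) + 1))
    (fun m => (m 17 = 2 ^ wg /\ m 18 = 24) /\
       (forall i, i < length total -> m (24 + i) = nth i total 0 mod 2 ^ wg) /\
       (forall i, 24 + length total <= i -> m i = m0 i)).
Proof.
  intros Hfit Hwg.
  assert (Hp : 2 ^ wg < 2 ^ w) by (apply Nat.pow_lt_mono_r; lia).
  pose proof (pow2_pos wg) as Hp0.
  set (J := fun k (m : nat -> nat) => m 10 = k /\ k <= length total /\ m 6 = 24 + k /\
     (m 2 = 1 /\ m 17 = 2 ^ wg /\ m 18 = 24) /\
     (forall i, i < k -> m (24 + i) = nth i total 0) /\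
     (forall i, k <= i < length total -> m (24 + i) = nth i total 0 mod 2 ^ wg) /\
     (forall i, 24 + length total <= i -> m i = m0 i)).
  apply hoare_seq with (Q := J (length total)).
  - apply (hoare_block w _ _ [_]); [repeat constructor|].
    intros m (g & rest & ((G2 & G17 & G18) & ->) & L & EL & M6 & ML & Mg & M0).
    rewrite app_nil_r in EL. subst L.
    rewrite <- Mg in G2, G17, G18 by (unfold reg; lia).
    unfold effs, J; cbn [fold_left eff binop_eval]. repeat split; auto; try (upds; auto; lia); try (intros; lia).
    + upds. rewrite M6, G18, Nat.mod_small; lia.
    + intros i Hi. upds. auto.
  - refine (hoare_conseq w _ _ _ _ _ _ _
      (hoare_while_count w J 10 _ 5 _ _ (length total)) _ _ (le_n _)).
    + intros k m Hm; apply Hm.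
    + intros k. apply (hoare_block w _ _ [_; _; _; _; _]); [repeat constructor|].
      intros m (M10 & Hk & M6 & (M2 & M17 & M18) & ML & MR & M0).
      unfold effs; cbn [fold_left eff binop_eval].
      set (ma := upd w m 10 (m 10 - m 2)).
      assert (A : forall i, i <> 10 -> ma i = m i) by (intros; unfold ma; upds; auto).
      assert (A10 : ma 10 = k) by (unfold ma; upds; rewrite M10, M2, Nat.mod_small; lia).
      rewrite (A 6), (A 2) by lia.
      set (mb := upd w ma 6 (m 6 - m 2)).
      assert (B : forall i, i <> 6 -> mb i = ma i) by (intros; unfold mb; upds; auto).
      assert (B6 : mb 6 = 24 + k) by (unfold mb; upds; rewrite M6, M2, Nat.mod_small; lia).
      rewrite B6, (B (24 + k)), (A (24 + k)), ML by lia.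
      set (mc := upd w mb 8 (nth k total 0)).
      set (v := mc 8 mod mc 17).
      assert (Hv : v = nth k total 0 mod 2 ^ wg).
      { unfold v, mc. rewrite upd_eq, upd_neq, B, A, M17 by lia. apply mod_pow_mod; lia. }
      assert (C : forall i, i <> 8 -> upd w mc 8 v i = mb i)
        by (intros; unfold mc; upds; auto).
      rewrite (C 6), B6 by lia.
      assert (Hv' : upd w mc 8 v 8 = v).
      { rewrite upd_eq. apply Nat.mod_small. rewrite Hv.
        pose proof (Nat.mod_upper_bound (nth k total 0) (2 ^ wg)). lia. }
      rewrite Hv'. set (md := upd w mc 8 v) in *.
      assert (E : forall i, i <> 24 + k -> i <> 8 -> i <> 6 -> i <> 10 ->
                 upd w md (24 + k) v i = m i)
        by (intros; rewrite upd_neq, C, B, A by lia; auto).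
      split; [rewrite upd_neq, C, B by lia; exact A10|]. split; [lia|].
      split; [rewrite upd_neq, C by lia; exact B6|].
      split; [rewrite !E by lia; auto|]. split; [|split].
      * intros i Hi. rewrite E by lia. apply ML; lia.
      * intros i Hi. destruct (Nat.eq_dec i k) as [->|Hne].
        -- rewrite upd_eq, Hv. apply Nat.mod_small.
           pose proof (Nat.mod_upper_bound (nth k total 0) (2 ^ wg)). lia.
        -- rewrite E by lia. apply MR; lia.
      * intros i Hi. rewrite E by lia. auto.
    + auto.
    + intros m (_ & _ & _ & (_ & M17 & M18) & _ & MR & M0). repeat split; auto.
      intros i Hi. apply MR; lia.
Qed.

(** * The reduction *)

Lemma length_hyperedges H :
  valid_hypergraph H -> length (snd H) <= fst H * fst H * fst H.
Proof.
  intros [Hnd Hv]. set (l := seq 0 (fst H)).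
  assert (Hl : length l = fst H) by apply length_seq.
  rewrite <- Hl, <- !length_prod. apply NoDup_incl_length; auto.
  intros [[a b] c] Hin. apply Hv in Hin. unfold l.
  repeat apply in_prod; apply in_seq; lia.
Qed.

Lemma hypergraph_order_ge H : valid_hypergraph H -> snd H <> [] -> 3 <= fst H.
Proof.
  intros [_ Hv] Hne. destruct (snd H) as [|[[a b] d] l]; [contradiction|].
  specialize (Hv a b d (or_introl eq_refl)). lia.
Qed.

Lemma gm_graph_of_le H :
  valid_hypergraph H -> gm (graph_of H) <= 26 * (fst H * fst H * fst H).
Proof.
  intros HV. pose proof (gm_graph_of H). pose proof (length_hyperedges H HV).
  assert (2 * fst H * fst H * (fst H - 1) <= 2 * (fst H * fst H * fst H)) by nia. lia.
Qed.

(** The assumed time bound holds only from a threshold on; when it is measured in edges, large [n]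
    must force many edges. *)
Lemma gm_graph_of_ge H :
  valid_hypergraph H -> snd H <> [] -> fst H * fst H <= gm (graph_of H).
Proof.
  intros HV Hne. pose proof (gm_graph_of H). pose proof (hypergraph_order_ge H HV Hne).
  assert (fst H * fst H <= 2 * fst H * fst H * (fst H - 1)) by nia. lia.
Qed.

(** With the next lemma this turns comparisons of word sizes into comparisons of powers of [n]. *)
Lemma pow_word_size_ge c n : n ^ c <= 2 ^ word_size c n.
Proof.
  unfold word_size. rewrite Nat.mul_comm, Nat.pow_mul_r.
  apply Nat.pow_le_mono_l. destruct (Nat.eq_dec n 0) as [->|Hn]; [lia|].
  pose proof (Nat.log2_spec n). lia.
Qed.

Lemma pow_word_size_le c n : 0 < n -> 2 ^ word_size c n <= (2 * n) ^ c.
Proof.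
  intros Hn. unfold word_size. rewrite Nat.mul_comm, Nat.pow_mul_r.
  apply Nat.pow_le_mono_l. pose proof (Nat.log2_spec n).
  rewrite Nat.pow_succ_r'. lia.
Qed.

Definition reduction_front (k c : nat) : com :=
  prologue k ;; generator c ;; normalize.

(* A hypergraph without hyperedges is rejected at once, as the address [h * n ^ k]
   of the prologue would be 0. *)
Definition reduction_program (k c : nat) (p : program) : program :=
  let front := compile 3 (reduction_front k c) in
  [IJz 1 2; IJmp 3; IHalt 1] ++ front ++ sim (3 + length front) p.

Section Reduction.

Variables (p : program) (c : nat).

(** [D] exceeds every address in the text of [p]. In [n ^ k] the factor [n ^ (7 * c)] covers
    [2 ^ wg], [n ^ (D + 3)] covers [24 + D], and [n ^ 7] is left for constants and for the length of
    the output. The 6 added in [c'] gives room for [h <= n ^ 3] in [F] and for a further constant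
    factor. *)
Let D := S (list_max (flat_map direct p)).
Let k := 7 * c + D + 10.
Let c' := k + 6.
Let q := reduction_program k c p.

Section Instance.

Variable H : hypergraph.
Hypothesis HV : valid_hypergraph H.
Hypothesis Hne : snd H <> [].

Let n := fst H.
Let h := length (snd H).
Let G := graph_of H.
Let w := word_size c' n.
Let wg := word_size c (gn G).
Let F := h * n ^ k.

Lemma h_bounds : 3 <= n /\ 0 < h <= n * n * n.
Proof.
  split; [apply hypergraph_order_ge; auto|].
  split; [|apply length_hyperedges, HV].
  unfold h. destruct (snd H); [contradiction|simpl; lia].
Qed.

Lemma gn_bounds : 0 < gn G <= 26 * (n * n * n).
Proof.
  pose proof h_bounds as [? _]. change (gn G) with (4 * (n * n)). nia.
Qed.

Lemma pow_k_ge : 64 * (n * n * n) + 74 <= n ^ k /\ 24 + (2 ^ wg + D) <= n ^ k.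
Proof.
  pose proof h_bounds as [Hn _]. pose proof gn_bounds as Hs.
  assert (Hn3 : 27 <= n * n * n).
  { assert (9 <= n * n) by nia. nia. }
  (* [n >= 3] lets the power [n ^ 7] absorb constants; together with [gn_bounds] it gives
     [2 * gn G <= n ^ 7]. *)
  assert (H7 : 81 * (n * n * n) <= n ^ 7).
  { replace (n ^ 7) with ((n * n * n) * (n * n * n) * n) by (simpl; lia).
    assert (27 * (n * n * n) <= (n * n * n) * (n * n * n)) by nia. nia. }
  split.
  - assert (n ^ 7 <= n ^ k) by (apply Nat.pow_le_mono_r; unfold k; lia). lia.
  - assert (Hw : 2 ^ wg <= n ^ (7 * c)).
    { unfold wg. etransitivity; [apply pow_word_size_le; lia|].
      rewrite Nat.pow_mul_r. apply Nat.pow_le_mono_l. lia. }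
    assert (HD : 24 + D <= n ^ (D + 3)).
    { etransitivity; [|apply Nat.pow_le_mono_l with (1 := Hn)].
      rewrite Nat.pow_add_r. pose proof (Nat.pow_gt_lin_r 3 D). simpl (3 ^ 3). lia. }
    assert (Ha : 0 < n ^ (7 * c)) by (apply Nat.neq_0_lt_0, Nat.pow_nonzero; lia).
    assert (Hb : 0 < n ^ (D + 3)) by (apply Nat.neq_0_lt_0, Nat.pow_nonzero; lia).
    assert (n ^ k = n ^ (7 * c) * n ^ (D + 3) * n ^ 7)
      by (rewrite <- !Nat.pow_add_r; f_equal; unfold k; lia).
    assert (2 <= n ^ 7) by lia.
    assert (n ^ (7 * c) * n ^ (D + 3) * 2 <= n ^ k) by nia.
    assert (n ^ (7 * c) + n ^ (D + 3) <= n ^ (7 * c) * n ^ (D + 3) * 2) by nia.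
    lia.
Qed.

Lemma F_bounds : n ^ k <= F /\ F + 3 * h + 24 < 2 ^ w.
Proof.
  pose proof h_bounds as [Hn Hh]. destruct pow_k_ge as [Hk _].
  split; [unfold F; nia|].
  assert (Hw : n ^ c' <= 2 ^ w) by apply pow_word_size_ge.
  assert (E : n ^ c' = n ^ k * (n * n * n) * (n * n * n)).
  { unfold c'. rewrite Nat.pow_add_r. simpl (n ^ 6). lia. }
  assert (Hn3 : 27 <= n * n * n).
  { assert (9 <= n * n) by nia. nia. }
  assert (HF : F <= n ^ k * (n * n * n)) by (unfold F; nia).
  assert (n ^ k <= n ^ k * (n * n * n)) by nia.
  assert (3 * (n ^ k * (n * n * n)) <= n ^ c') by nia.
  lia.
Qed.

Lemma wg_lt_w : wg < w.
Proof.
  destruct pow_k_ge as [_ Hk]. destruct F_bounds as [HF HF'].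
  apply (Nat.pow_lt_mono_r_iff 2); lia.
Qed.

Lemma enc_hypergraph_lt i : nth i (enc_hypergraph H) 0 < 2 ^ w.
Proof.
  pose proof h_bounds as [Hn Hh]. pose proof pow_k_ge as [Hk _].
  pose proof F_bounds as [HF HF']. assert (n <= n * n) by nia.
  assert (n * n <= n * n * n) by nia.
  destruct (nth_in_or_default i (enc_hypergraph H) 0) as [Hin|E];
    [|rewrite E; apply pow2_pos].
  destruct Hin as [<-|[<-|Hin]]; [fold n; lia|fold h; lia|].
  apply in_flat_map in Hin as ([[a b] d] & Hin & Hx). apply HV in Hin. fold n in Hin.
  destruct Hx as [<-|[<-|[<-|[]]]]; lia.
Qed.

Lemma reduction_front_spec :
  hoare w (fun m => forall i, m i = nth i (enc_hypergraph H) 0)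
    (reduction_front k c) ((2000 + 2 * k + 2 * c) * (n * n * n))
    (simulates wg (2 ^ wg + D) (fun i => nth i (enc_graph G) 0 mod 2 ^ wg)).
Proof.
  pose proof h_bounds as [Hn Hh]. pose proof (gm_graph_of_le H HV) as Hm. fold G n in Hm.
  pose proof gn_bounds as Hs. pose proof pow_k_ge as [Hk1 Hk2].
  pose proof F_bounds as [HF1 HF2]. pose proof wg_lt_w as Hwg.
  assert (Hlen : length (enc_graph G) = 2 + 2 * gm G) by apply (length_total H).
  assert (Hleni : length (enc_hypergraph H) = 2 + 3 * h)
    by (unfold h; rewrite <- length_enc_hedges; reflexivity).
  assert (Hgm : 24 * h <= gm G) by (unfold G; rewrite gm_graph_of; apply Nat.le_add_r).
  assert (Hnn : n * n <= n * n * n) by nia.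
  pose proof enc_hypergraph_lt as Hinp.
  intros m Hm0.
  destruct (prologue_spec w (enc_hypergraph H) n h k) with (m := m)
    as (t1 & m1 & Ht1 & Hr1 & ([M0 M2] & MF & MI) & M4 & M3 & M6); auto;
    try (fold F; lia).
  assert (Hfit : 24 + length (enc_graph G) < 2 ^ w) by lia.
  destruct (generator_spec w m1 H F HV) with (c := c) (m := m1)
    as (t2 & m2 & Ht2 & Hr2 & Hq2); try (fold n G; lia); auto.
  - intros i Hi. rewrite MF by exact Hi. rewrite Nat.add_comm. reflexivity.
  - exists m1, (enc_graph G). split; [repeat split; auto|].
    exists []. repeat split; auto; simpl; lia.
  - destruct (normalize_spec w (enc_graph G) m1 wg) with (m := m2)
      as (t3 & m3 & Ht3 & Hr3 & (M17 & M18) & ML & MR); auto.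
    exists (t1 + (t2 + t3)), m3. split; [|split].
    + fold n h G in Ht2. rewrite Hlen in Ht3. clear - Ht1 Ht2 Ht3 Hh Hm Hs Hn Hnn.
      assert (k <= k * (n * n * n)) by nia. assert (c <= c * (n * n * n)) by nia.
      lia.
    + repeat (econstructor; eauto).
    + repeat split; auto.
      * intros i. apply Nat.mod_upper_bound. pose proof (pow2_pos wg); lia.
      * intros i Hi. destruct (Nat.lt_ge_cases i (length (enc_graph G))) as [Hl|Hl]; [auto|].
        (* Past the encoding both memories are 0: up to [F] the host still has its initial contents
           there, and by [Hgm] the encoded graph is at least as long as the input. *)
        rewrite MR, MI by lia. rewrite !nth_overflow by lia.
        symmetry; apply Nat.Div0.mod_0_l.
Qed.

Lemma reduction_exec t b :
  exec wg p t (init_state wg (enc_graph G)) = Halted b ->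
  exists t', t' <= (2002 + 2 * k + 2 * c) * (n * n * n) + 3 * t /\
    exec w q t' (init_state w (enc_hypergraph H)) = Halted b.
Proof.
  intros He. pose proof h_bounds as [Hn Hh].
  pose proof pow_k_ge as [Hk1 Hk2].
  pose proof F_bounds as [HF1 HF2]. pose proof wg_lt_w as Hwg.
  set (m := fun i => nth i (enc_hypergraph H) 0 mod 2 ^ w).
  destruct (reduction_front_spec m) as (t1 & m1 & Ht1 & Hr1 & HS).
  { intros i. apply Nat.mod_small, enc_hypergraph_lt. }
  set (front := compile 3 (reduction_front k c)).
  destruct (simulate_exec w wg (2 ^ wg + D) (3 + length front) p q) with
    (pc := 0) (v := fun i => nth i (enc_graph G) 0 mod 2 ^ wg) (m := m1) (t := t) (b := b)
    as (t2 & Ht2 & He2); auto; try lia.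
  - intros i a Hi Ha. pose proof (list_max_le (flat_map direct p) (list_max (flat_map direct p))) as [Hle _].
    specialize (Hle (le_n _)). rewrite Forall_forall in Hle.
    specialize (Hle a). unfold D. assert (In a (flat_map direct p)) by (apply in_flat_map; eauto).
    apply Hle in H0. lia.
  - intros i ins Hi. unfold q, reduction_program. fold front.
    rewrite app_assoc, nth_error_app2; [|rewrite length_app; simpl; lia].
    rewrite <- Hi. f_equal. rewrite length_app; simpl; lia.
  - unfold q, reduction_program. fold front. rewrite !length_app, length_sim. simpl; lia.
  - exists (2 + (t1 + t2)). split; [nia|].
    unfold init_state. fold m. rewrite exec_add.
    assert (E2 : exec w q 2 (Running 0 m) = Running 3 m).
    { assert (E : m 1 = h).
      { unfold m. change (nth 1 (enc_hypergraph H) 0) with h. apply Nat.mod_small; lia. }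
      rewrite (exec_add w q 1 1), exec_1. unfold step.
      change (nth_error q 0) with (Some (IJz 1 2)). cbv iota beta. rewrite E.
      destruct (Nat.eqb_spec h 0); [lia|]. reflexivity. }
    rewrite E2, exec_add, (exec_compile w q _ _ _ _ Hr1 3).
    + fold front. rewrite Nat.mul_0_r, Nat.add_0_r in He2. exact He2.
    + fold front. intros i ins Hi. unfold q, reduction_program. fold front.
      rewrite nth_error_app2 by (simpl; lia).
      rewrite nth_error_app1; [rewrite <- Hi; f_equal; simpl; lia|].
      simpl (length _). apply nth_error_Some.
      replace (3 + i - 3) with i by lia. congruence.
Qed.

End Instance.

Lemma reduction_exec_empty H :
  snd H = [] ->
  exec (word_size c' (fst H)) q 2 (init_state (word_size c' (fst H)) (enc_hypergraph H))
  = Halted false.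
Proof.
  intros E. unfold init_state, enc_hypergraph. rewrite E.
  set (w := word_size c' (fst H)).
  rewrite (exec_add w q 1 1), exec_1. unfold step.
  change (nth_error q 0) with (Some (IJz 1 2)). cbn [length nth].
  rewrite Nat.Div0.mod_0_l. cbn [Nat.eqb]. rewrite exec_1. unfold step.
  change (nth_error q 2) with (Some (IHalt 1)). cbn [length nth].
  rewrite Nat.Div0.mod_0_l. reflexivity.
Qed.

End Reduction.

(** * Real exponents and the time bounds *)

Open Scope R_scope.

Lemma Rpower_le_exponent x a b : 1 <= x -> a <= b -> Rpower x a <= Rpower x b.
Proof.
  intros [Hx| <-] Hab; [apply Rle_Rpower; lra|].
  unfold Rpower. rewrite ln_1, !Rmult_0_r. lra.
Qed.

Lemma Rpower_ge_1 x e : 1 <= x -> 0 <= e -> 1 <= Rpower x e.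
Proof.
  intros Hx He. rewrite <- (Rpower_O x) by lra. apply Rpower_le_exponent; auto.
Qed.

Lemma Rpower_pos x e : 0 < Rpower x e.
Proof. apply exp_pos. Qed.

Lemma Rpower_scale_le (s a x e : R) (j : nat) :
  0 < s -> 0 < a -> 1 <= x -> 0 <= e -> s <= a * x ^ j ->
  Rpower s e <= Rpower a e * Rpower x (INR j * e).
Proof.
  intros Hs Ha Hx He Hle.
  rewrite <- Rpower_mult, Rpower_pow, Rpower_mult_distr by (try apply pow_lt; lra).
  apply Rle_Rpower_l; lra.
Qed.

(** With [N = 4 n^2] nodes, [N^(3/2) = 8 n^3], so [K = 4] allows [32 n^3] edges, more than the
    [26 n^3] that can occur. *)
Lemma valid_graph_K_graph_of H :
  valid_hypergraph H -> snd H <> [] -> valid_graph_K 4 (graph_of H).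
Proof.
  intros HV Hne. split; [apply valid_graph_of; auto|].
  pose proof (gm_graph_of_le H HV) as Hm.
  pose proof (hypergraph_order_ge H HV Hne) as Hn.
  apply le_INR in Hm, Hn. rewrite !mult_INR in Hm. simpl (INR 3) in Hn.
  replace (INR 26) with 26 in Hm by (simpl; ring).
  change (gn (graph_of H)) with (4 * (fst H * fst H))%nat. rewrite !mult_INR.
  replace (INR 4) with 4 by (simpl; ring).
  set (x := INR (fst H)) in *.
  replace (4 * (x * x)) with (Rpower (2 * x) (INR 2))
    by (rewrite Rpower_pow by lra; simpl; ring).
  rewrite Rpower_mult. replace (INR 2 * (3 / 2)) with (INR 3) by (simpl; field).
  rewrite Rpower_pow by lra.
  assert (0 < x * x * x) by (repeat apply Rmult_lt_0_compat; lra).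
  simpl. lra.
Qed.

(** Abstract in the size and in the time bound, to serve for edges and nodes alike. [eps <= 1] lets
    the cubic cost of writing the graph disappear in the target bound. *)
Lemma hyperclique_of_C4 (size : graph -> nat) (f : nat -> R) (B eps : R) :
  (forall H, valid_hypergraph H -> snd H <> [] -> (fst H <= size (graph_of H))%nat) ->
  0 < eps <= 1 -> 0 <= B -> (forall m, 0 <= f m) ->
  (forall H, valid_hypergraph H -> snd H <> [] ->
     f (size (graph_of H)) <= B * Rpower (INR (fst H)) (4 - eps)) ->
  decides_in_time (valid_graph_K 4) enc_graph gn has_induced_C4 size f ->
  decides_in_time valid_hypergraph enc_hypergraph fst has_4_hyperclique fst
    (fun n => Rpower (INR n) (4 - eps)).
Proof.
  intros Hsize Heps HB0 Hf HB (p & c & Hdec & C & n0 & Htime).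
  set (k := (7 * c + S (list_max (flat_map direct p)) + 10)%nat).
  exists (reduction_program k c p), (k + 6)%nat.
  assert (Hempty : forall H, snd H = [] -> false = true <-> has_4_hyperclique H).
  { intros H E. split; [discriminate|].
    intros (a & b & c1 & d & _ & (x & y & z & Hin & _) & _). rewrite E in Hin. destruct Hin. }
  split.
  - intros H HV. destruct (snd H) as [|e l] eqn:E.
    + exists 2%nat, false. split; [apply (reduction_exec_empty p c H E)|auto].
    + assert (Hne : snd H <> []) by congruence.
      destruct (Hdec (graph_of H)) as (t & b & He & Hb);
        [apply valid_graph_K_graph_of; auto|].
      destruct (reduction_exec p c H HV Hne t b He) as (t' & _ & He').
      exists t', b. split; [exact He'|]. rewrite Hb. apply induced_C4_graph_of; auto.
  - set (A := (2002 + 2 * k + 2 * c)%nat).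
    (* 2 pays for rejecting the empty hypergraph, [A] for building the graph, 3 for the simulation.
       [C] may be negative, hence [Rabs]; [S n0] ensures [n >= 1], so that powers are at least 1. *)
    exists (2 + INR A + 3 * (Rabs C * B)), (S n0). intros H HV Hn.
    assert (Hx : 1 <= INR (fst H)) by (apply (le_INR 1); lia).
    set (x := INR (fst H)) in *.
    assert (Hp1 : 1 <= Rpower x (4 - eps)) by (apply Rpower_ge_1; lra).
    assert (HA : 0 <= INR A) by apply pos_INR.
    pose proof (Rabs_pos C) as HC.
    assert (HCB : 0 <= Rabs C * B * Rpower x (4 - eps))
      by (repeat apply Rmult_le_pos; lra).
    assert (HAp : 0 <= INR A * Rpower x (4 - eps)) by (apply Rmult_le_pos; lra).
    destruct (snd H) as [|e l] eqn:E.
    + exists 2%nat, false. split; [|split; [apply (reduction_exec_empty p c H E)|auto]].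
      simpl (INR 2). lra.
    + assert (Hne : snd H <> []) by congruence.
      destruct (Htime (graph_of H)) as (t & b & Ht & He & Hb).
      * apply valid_graph_K_graph_of; auto.
      * specialize (Hsize H HV Hne). lia.
      * destruct (reduction_exec p c H HV Hne t b He) as (t' & Ht' & He').
        exists t', b. split; [|split; [exact He'|]].
        -- apply le_INR in Ht'. rewrite plus_INR, !mult_INR in Ht'. fold k x in Ht'.
           fold A in Ht'. replace (INR 3) with 3 in Ht' by (simpl; ring).
           assert (H3 : x * x * x <= Rpower x (4 - eps)).
           { replace (x * x * x) with (Rpower x (INR 3)) by (rewrite Rpower_pow by lra; simpl; ring).
             apply Rpower_le_exponent; simpl; lra. }
           specialize (HB H HV Hne). fold x in HB.
           assert (Ht2 : INR t <= Rabs C * B * Rpower x (4 - eps)).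
           { apply Rle_trans with (1 := Ht). rewrite Rmult_assoc.
             apply Rle_trans with (Rabs C * f (size (graph_of H))).
             - apply Rmult_le_compat_r; [apply Hf|apply Rle_abs].
             - apply Rmult_le_compat_l; auto. }
           assert (Ht3 : INR A * (x * x * x) <= INR A * Rpower x (4 - eps))
             by (apply Rmult_le_compat_l; auto).
           lra.
        -- rewrite Hb. apply induced_C4_graph_of; auto.
Qed.

Theorem theorem17 :
  hyperclique_hypothesis ->
  exists K : R, 0 < K /\
    forall eps : R, 0 < eps ->
      ~ decides_in_time (valid_graph_K K) enc_graph gn has_induced_C4 gm
          (fun m => Rpower (INR m) (4 / 3 - eps)) /\
      ~ decides_in_time (valid_graph_K K) enc_graph gn has_induced_C4 gn
          (fun n => Rpower (INR n) (2 - eps)).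
Proof.
  intros Hhyp. exists 4. split; [lra|]. intros eps Heps.
  (* The cap 1/3 makes [3 * d <= 1] and keeps the exponents [4 / 3 - d] and [2 - d] positive. All
     sizes are at least 1, so the bound with [eps] is below the one with [d]. *)
  set (d := Rmin eps (1 / 3)).
  assert (Hd : 0 < d <= 1 / 3 /\ d <= eps).
  { unfold d. pose proof (Rmin_l eps (1 / 3)). pose proof (Rmin_r eps (1 / 3)).
    assert (0 < Rmin eps (1 / 3)) by (apply Rmin_glb_lt; lra). lra. }
  assert (Hsz : forall H, valid_hypergraph H -> snd H <> [] ->
    1 <= INR (fst H) /\ 1 <= INR (gm (graph_of H)) /\
    INR (gm (graph_of H)) <= 26 * INR (fst H) ^ 3 /\
    INR (gn (graph_of H)) = 4 * INR (fst H) ^ 2).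
  { intros H HV Hne. pose proof (gm_graph_of_le H HV) as Hle.
    pose proof (gm_graph_of_ge H HV Hne) as Hge.
    pose proof (hypergraph_order_ge H HV Hne) as Hn.
    apply le_INR in Hle. rewrite !mult_INR in Hle.
    replace (INR 26) with 26 in Hle by (simpl; ring).
    split; [apply (le_INR 1); lia|]. split; [apply (le_INR 1); nia|]. split; [lra|].
    change (gn (graph_of H)) with (4 * (fst H * fst H))%nat.
    rewrite !mult_INR. simpl. ring. }
  split; intros Hdec.
  (* From [m <= 26 n^3], [m^(4/3 - d)] is O(n^(4 - 3 d)). *)
  - apply (Hhyp (3 * d)); [lra|].
    apply (hyperclique_of_C4 gm (fun m => Rpower (INR m) (4 / 3 - eps))
      (Rpower 26 (4 / 3 - d))); auto; try lra.
    + intros H HV Hne. pose proof (gm_graph_of_ge H HV Hne). nia.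
    + apply Rlt_le, Rpower_pos.
    + intros m. apply Rlt_le, Rpower_pos.
    + intros H HV Hne. destruct (Hsz H HV Hne) as (Hx & Hm & Hle & _).
      apply Rle_trans with (Rpower (INR (gm (graph_of H))) (4 / 3 - d)).
      * apply Rpower_le_exponent; lra.
      * replace (4 - 3 * d) with (INR 3 * (4 / 3 - d)) by (simpl; field).
        apply Rpower_scale_le; auto; lra.
  (* From [N = 4 n^2], [N^(2 - d)] is O(n^(4 - 2 d)). *)
  - apply (Hhyp (2 * d)); [lra|].
    apply (hyperclique_of_C4 gn (fun m => Rpower (INR m) (2 - eps))
      (Rpower 4 (2 - d))); auto; try lra.
    + intros H HV Hne. change (gn (graph_of H)) with (4 * (fst H * fst H))%nat. nia.
    + apply Rlt_le, Rpower_pos.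
    + intros m. apply Rlt_le, Rpower_pos.
    + intros H HV Hne. destruct (Hsz H HV Hne) as (Hx & _ & _ & E).
      assert (1 <= INR (fst H) ^ 2) by (apply pow_R1_Rle; auto).
      apply Rle_trans with (Rpower (INR (gn (graph_of H))) (2 - d)).
      * apply Rpower_le_exponent; lra.
      * replace (4 - 2 * d) with (INR 2 * (2 - d)) by (simpl; ring).
        apply Rpower_scale_le; lra.
Qed.
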